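(* Let $(\mathfrak g,H,\mathcal G_g)$ be a four-dimensional almost Abelian generalised pseudo-Riemannian Lie algebra of signature $(2,2)$ with codimension one Abelian ideal $\mathfrak n$ such that $\mathfrak n$ is non-degenerate. Let $X\in\mathfrak n^\perp$ with $g(X,X)\in\{-1,1\}$ and $f:=\mathrm{ad}_X|_{\mathfrak n}$. Then $(\mathfrak g,H,\mathcal G_g)$ is generalised Einstein for zero divergence operator if and only if there are $\varepsilon\in\{-1,1\}$ and an orthonormal basis $(e_1,e_2,e_3)$ of $\mathfrak n$ with $g(e_1,e_1)=-g(e_2,e_2)=-g(e_3,e_3)=-\varepsilon$ with respect to which one of the following holds: (ii) $H=0$, $f=\begin{pmatrix}0&0&-1+\sigma\\ 0&0&-1-\sigma\\ -1+\sigma&1+\sigma&0\end{pmatrix}$ for some $\sigma\in\mathbb R$; (iii) $H=0$, $f=\begin{pmatrix}\alpha&-\beta&0\\ \beta&\alpha&0\\ 0&0&a\end{pmatrix}$ with $\beta=\sqrt{\alpha^2+\frac{a^2}2}$ for some $(\alpha,a)\in\mathbb R^2\setminus\{(0,0)\}$; (iv) $H=0$, $f=\begin{pmatrix}\frac\epsilon2&\frac\epsilon2&v\\ -\frac\epsilon2&-\frac\epsilon2&-v\\ v&v&0\end{pmatrix}$ for some $\epsilon\in\{-1,1\}$, $v\in\mathbb R$; (v) $H=0$, $f=\frac1{\sqrt2}\begin{pmatrix}0&-1&0\\ 1&0&1\\ 0&1&0\end{pmatrix}$; (vi) $H=a\,(e^{12}-e^{23})\wedge X^\flat$, $f=\frac1{\sqrt2}\begin{pmatrix}0&-1-\frac{a^2}2&0\\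 1-\frac{a^2}2&0&1-\frac{a^2}2\\ 0&1+\frac{a^2}2&0\end{pmatrix}$ for some $a\in\mathbb R\setminus\{0\}$.
   Context: Let $\mathfrak g$ be a finite-dimensional real Lie algebra. A generalised pseudo-Riemannian metric on $\mathfrak g$ is a pair $(H,\mathcal G_g)$ where $H\in\Lambda^3\mathfrak g^*$ is closed for the Chevalley–Eilenberg differential (normalised by $d\alpha(X,Y)=-\alpha([X,Y])$), $g$ is a non-degenerate symmetric bilinear form on $\mathfrak g$ (whose signature is called the signature of $(H,\mathcal G_g)$), and $\mathcal G_g$ is the endomorphism of $E=\mathfrak g\oplus\mathfrak g^*$ given by $\mathcal G_g(X+\xi)=\xi^\sharp+X^\flat$, with $X^\flat=g(X,\cdot)$ and $\sharp=\flat^{-1}$; then $(\mathfrak g,H,\mathcal G_g)$ is called a generalised pseudo-Riemannian Lie algebra. Let $E_\pm=\{X\pm X^\flat\mid X\in\mathfrak g\}$ be the $\pm1$-eigenspaces of $\mathcal G_g$ and $\pi_\pm=\frac12(\mathrm{id}\pm\mathcal G_g):E\to E_\pm$. The $H$-twisted Dorfman bracket on $E$ is $[X+\xi,Y+\eta]_H=[X,Y]+d\eta(X,\cdot)-d\xi(Y,\cdot)+H(X,Y,\cdot)$. For $u\in E_+$, $v\in E_-$ put $\Gamma_u=\pi_+\circ[u,\cdot]_H|_{E_-}:E_-\to E_+$ and $\Gamma_v=\pi_-\circ[v,\cdot]_H|_{E_+}:E_+\to E_-$. For a divergence operator $\delta\in E^*$ the generalised Ricci curvatures are, by a known result taken here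 as definition, $\mathcal{RC}^+(v,u)=-\mathrm{tr}(\Gamma_v\circ\Gamma_u)+\delta(\pi_+[v,u]_H)$ and $\mathcal{RC}^-(u,v)=-\mathrm{tr}(\Gamma_v\circ\Gamma_u)+\delta(\pi_-[u,v]_H)$; $(\mathfrak g,H,\mathcal G_g,\delta)$ is generalised Einstein if both vanish identically. For $\delta=0$ this means $\mathrm{tr}(\Gamma_v\circ\Gamma_u)=0$ for all $u\in E_+$, $v\in E_-$. A Lie algebra is almost Abelian if it has a codimension one Abelian ideal. A subspace is non-degenerate if the restriction of $g$ to it is. Matrices act on columns of coordinates ($f(e_j)=\sum_if_{ij}e_i$). $e^1,e^2,e^3$ are the dual one-forms, extended by $e^i(X)=0$; $e^{ij}=e^i\wedge e^j$. The item numbers (ii)–(vi) are those of the corresponding Lorentzian classification.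
   Formalization: The Lie algebra is additionally assumed non-Abelian: for the Abelian Lie algebra with H=0 the structure is generalised Einstein with zero divergence, but f=0 is none of the forms (ii)–(vi). *)

(* Defs.v *)
From HB Require Import structures.
From mathcomp Require Import all_boot all_order all_algebra.
From mathcomp Require Export sesquilinear.
From mathcomp Require Export reals.

Set Implicit Arguments.
Unset Strict Implicit.
Unset Printing Implicit Defensive.

Import Order.TTheory GRing.Theory Num.Theory passmx.
Local Open Scope ring_scope.

Section LieAlgebra.
Variables (R : realType) (V : vectType R) (br : {bilinear V -> V -> V}).

Definition lie_bracket :=
  (forall x, br x x = 0) /\
  (forall x y z, br x (br y z) + br y (br z x) + br z (br x y) = 0).

(* The zero bracket has to be excluded from the almost Abelian Lie algebras:
   with H = 0 it is generalised Einstein for zero divergence, but f = 0 is not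
   one of the normal forms of the classification. *)
Definition lie_abelian := forall x y, br x y = 0.

Definition codim1_abelian_ideal (n : {vspace V}) :=
  [/\ (\dim n).+1 = \dim {:V},
      forall x y, y \in n -> br x y \in n &
      forall x y, x \in n -> y \in n -> br x y = 0].

Definition dual : vectType R := 'Hom(V, R^o).

(* Chevalley-Eilenberg differential in degrees 1 and 3, with the sign
   convention d alpha (x, y) = - alpha [x, y]; in degree k,
   d alpha (x_0, ..., x_k) = \sum_(i < j)
     (-1)^(i + j) alpha ([x_i, x_j], x_0, .., ^x_i, .., ^x_j, .., x_k). *)
Definition d1 (alpha : dual) (x y : V) : R := - alpha (br x y).

Definition d3 (H : V -> V -> V -> R) (x0 x1 x2 x3 : V) : R :=
  - H (br x0 x1) x2 x3 + H (br x0 x2) x1 x3 - H (br x0 x3) x1 x2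
  - H (br x1 x2) x0 x3 + H (br x1 x3) x0 x2 - H (br x2 x3) x0 x1.

Definition form3 (H : V -> V -> V -> R) :=
  [/\ forall y z, scalar (fun x => H x y z),
      forall x z, scalar (fun y => H x y z),
      forall x y, scalar (fun z => H x y z) &
      forall x y, H x x y = 0 /\ H x y y = 0].

Definition closed3 (H : V -> V -> V -> R) :=
  forall x0 x1 x2 x3, d3 H x0 x1 x2 x3 = 0.

End LieAlgebra.

(* Normalised so that (alpha /\ beta)(x, y) = alpha x beta y - alpha y beta x
   and, on one-forms, /\ is associative (alpha /\ beta /\ gamma = det). *)
Definition wedge11 (R : realType) (V : vectType R) (alpha beta : V -> R)
    (x y : V) : R :=
  alpha x * beta y - alpha y * beta x.

Definition wedge21 (R : realType) (V : vectType R) (omega : V -> V -> R)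
    (gamma : V -> R) (x y z : V) : R :=
  omega x y * gamma z - omega x z * gamma y + omega y z * gamma x.

Section Metric.
Variables (R : realType) (V : vectType R) (g : {symmetric V}).

Definition has_signature (p q : nat) :=
  exists b : (p + q).-tuple V, basis_of {:V} b /\
    forall i j : 'I_(p + q),
      g b`_i b`_j = if i == j then (if (i < p)%N then 1 else -1) else 0.

Definition nondegenerate_on (U : {vspace V}) := (U :&: orthov g U == 0)%VS.

End Metric.

(* The trace does not depend on the basis chosen. *)
Definition lfun_trace (R : realType) (W : vectType R) (f : 'End(W)) : R :=
  \tr (mxof (vbasis {:W}) (vbasis {:W}) f).

Section Generalised.
Variables (R : realType) (V : vectType R) (br : {bilinear V -> V -> V}).
Variables (H : V -> V -> V -> R) (g : {symmetric V}).

Definition gen_pseudo_riemannian_lie_algebra :=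
  [/\ lie_bracket br, form3 H, closed3 br H & nondegenerate g].

Definition gen_tangent : vectType R := (V * dual V)%type.
Local Notation E := gen_tangent.

Definition flat : 'Hom(V, dual V) :=
  linfun (fun x => linfun (fun y => g x y : R^o) : dual V).

(* For nondegenerate g, flat is bijective and this is its two-sided inverse. *)
Definition sharp : 'Hom(dual V, V) := (flat^-1)%VF.

Definition Gmetric : 'End(E) := linfun (fun u : E => (sharp u.2, flat u.1) : E).

Definition Eplus : {vspace E} := leigenspace Gmetric 1.
Definition Eminus : {vspace E} := leigenspace Gmetric (-1).

Definition pi_plus (u : E) : E := 2^-1 *: (u + Gmetric u).
Definition pi_minus (u : E) : E := 2^-1 *: (u - Gmetric u).

Definition dorfman (u v : E) : E :=
  (br u.1 v.1,
   linfun (fun z => d1 br v.2 u.1 z - d1 br u.2 v.1 z + H u.1 v.1 z : R^o)).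

(* pi_plus and pi_minus take their values in Eplus and Eminus; vsproj only
   recasts these values as elements of the corresponding subspace types. *)
Definition Gamma_plus (u : subvs_of Eplus) :
    'Hom(subvs_of Eminus, subvs_of Eplus) :=
  linfun (fun w => vsproj Eplus (pi_plus (dorfman (vsval u) (vsval w)))).

Definition Gamma_minus (v : subvs_of Eminus) :
    'Hom(subvs_of Eplus, subvs_of Eminus) :=
  linfun (fun w => vsproj Eminus (pi_minus (dorfman (vsval v) (vsval w)))).

Variable delta : 'Hom(E, R^o).

Definition RC_plus (v : subvs_of Eminus) (u : subvs_of Eplus) : R :=
  - lfun_trace (Gamma_minus v \o Gamma_plus u)%VF
  + delta (pi_plus (dorfman (vsval v) (vsval u))).

Definition RC_minus (u : subvs_of Eplus) (v : subvs_of Eminus) : R :=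
  - lfun_trace (Gamma_minus v \o Gamma_plus u)%VF
  + delta (pi_minus (dorfman (vsval u) (vsval v))).

Definition gen_einstein :=
  (forall v u, RC_plus v u = 0) /\ (forall u v, RC_minus u v = 0).

End Generalised.

Section AdaptedBasis.
Variables (R : realType) (V : vectType R).

Definition mx33 (a11 a12 a13 a21 a22 a23 a31 a32 a33 : R) : 'M[R]_3 :=
  \matrix_(i, j) nth 0 (nth [::] [:: [:: a11; a12; a13];
                                     [:: a21; a22; a23];
                                     [:: a31; a32; a33]] i) j.

(* A represents phi on the span of e, acting on columns of coordinates
   (the library's mxof acts on rows, hence is the transpose). *)
Definition represents (phi : V -> V) (e : 3.-tuple V) (A : 'M[R]_3) :=
  forall j : 'I_3, phi e`_j = \sum_(i < 3) A i j *: e`_i.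

(* e = (e_1, e_2, e_3) is numbered from 0, so g e`_0 e`_0 is g(e_1, e_1). *)
Definition adapted_basis (g : {symmetric V}) (n : {vspace V}) (eps : R)
    (e : 3.-tuple V) :=
  [/\ basis_of n e,
      forall i j : 'I_3, i != j -> g e`_i e`_j = 0,
      g e`_0 e`_0 = - eps, g e`_1 e`_1 = eps & g e`_2 e`_2 = eps].

(* coframe e X i is e^{i+1} for i < 3: the i-th element of the basis dual to
   (e_1, e_2, e_3, X); in particular it vanishes on X. *)
Definition coframe (e : 3.-tuple V) (X : V) (i : 'I_4) : V -> R :=
  coord (rcons_tuple e X) i.

(* e^{ij} with the usual numbering from 1. *)
Definition e12 (e : 3.-tuple V) (X : V) : V -> V -> R :=
  wedge11 (coframe e X (inord 0)) (coframe e X (inord 1)).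
Definition e23 (e : 3.-tuple V) (X : V) : V -> V -> R :=
  wedge11 (coframe e X (inord 1)) (coframe e X (inord 2)).

End AdaptedBasis.

(* Main.v *)
Require Import Defs.
From HB Require Import structures.
From mathcomp Require Import all_boot all_order all_algebra.
From mathcomp Require Import sesquilinear reals.
From mathcomp Require Import ring lra.
Set Implicit Arguments.
Unset Strict Implicit.
Unset Printing Implicit Defensive.
Import Order.TTheory GRing.Theory Num.Theory.
Local Open Scope ring_scope.

(** Identify both E_+ and E_- with the Lie algebra through X |-> X +/- X^flat.
    Then Gamma_u and Gamma_v are given by the trilinear form [connection], and
    in a pseudo-orthonormal basis the traces become sums of products of its
    coefficients. In a basis (e_1, e_2, e_3, X) adapted to the Abelian ideal n,
    split f = ad_X into its g-symmetric and g-skew parts, f = s + k, and let W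
    be the skew endomorphism of n with g (W y) z = H (X, y, z). The Einstein
    equations become
      H = 0 on n,  tr s^2 = 0,  [s, k] = W^2 / 2,  {s, W} + [k, W] = 0.
    Taking traces, tr W^2 = 0. So if W is not zero, its kernel is a null line;
    after moving this line to a fixed one, the equations leave a family that
    null rotations and boosts reduce to (vi). If W = 0 and s = 0, then f is an
    arbitrary non-zero skew map, which is (ii). If W = 0 and s <> 0, then s
    commutes with k and has a real eigenvector: by tr s^2 = 0 it cannot be
    timelike, a spacelike one leads to (iii) or (iv), and a null one to (iv) or
    (v), which is (vi) with a = 0. *)

(** Multiplying [g] by [eps] turns the Gram matrix of n into one Lorentzian matrix for both signs,
    and working with bilinear forms instead of endomorphisms makes a change of frame a congruence
    [M^T *m b *m M], free of inverses. The component of H on n vanishes for two reasons together: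
    the traces with u along X are its products with the components of W, and the metric trace of the
    block on n makes its square a multiple of tr W^2, so its cube is zero. Afterwards the sign of g
    (X, X) is only a common factor. The obstacle in the classification is that a symmetric map need
    not be diagonalisable for an indefinite metric; the causal character of one real eigenvector,
    which exists because the characteristic polynomial is a cubic, replaces the spectral theorem.
    The forms (iv), (v) and (vi) all have a null vector in the kernel of f, so [classifiable_null]
    serves them together. Finally, the signature is given by a basis of the whole algebra, and a
    reflection moves three of its vectors into n, in place of the law of inertia. *)

Section Matrices33.
Variable R : realType.
Implicit Types (M N : 'M[R]_3).

(** * Explicit three-by-three matrices *)

Lemma forall_ord3 (P : 'I_3 -> Prop) : P 0 -> P 1 -> P 2 -> forall i, P i.
Proof.
move=> P0 P1 P2 [[|[|[|//]]] Hi].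
- by have -> : Ordinal Hi = 0 by exact/val_inj.
- by have -> : Ordinal Hi = 1 by exact/val_inj.
- by have -> : Ordinal Hi = 2 by exact/val_inj.
Qed.

Lemma sum_ord3 (U : nmodType) (F : 'I_3 -> U) :
  \sum_(i < 3) F i = F 0 + F 1 + F 2.
Proof.
rewrite !big_ord_recl big_ord0 addr0 addrA.
by congr (_ + F _ + F _); apply/val_inj.
Qed.

Lemma eta_mx33 M :
  M = mx33 (M 0 0) (M 0 1) (M 0 2) (M 1 0) (M 1 1) (M 1 2) (M 2 0) (M 2 1)
           (M 2 2).
Proof. by apply/matrixP; do 2!apply: forall_ord3; rewrite mxE. Qed.

Section Operations.
Variables a11 a12 a13 a21 a22 a23 a31 a32 a33 : R.
Variables b11 b12 b13 b21 b22 b23 b31 b32 b33 : R.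
Let A := mx33 a11 a12 a13 a21 a22 a23 a31 a32 a33.
Let B := mx33 b11 b12 b13 b21 b22 b23 b31 b32 b33.

Lemma mx33_inj : A = B ->
  [/\ [/\ a11 = b11, a12 = b12 & a13 = b13],
      [/\ a21 = b21, a22 = b22 & a23 = b23] &
      [/\ a31 = b31, a32 = b32 & a33 = b33]].
Proof.
move=> /matrixP E; split; split.
- by have := E 0 0; rewrite !mxE.
- by have := E 0 1; rewrite !mxE.
- by have := E 0 2; rewrite !mxE.
- by have := E 1 0; rewrite !mxE.
- by have := E 1 1; rewrite !mxE.
- by have := E 1 2; rewrite !mxE.
- by have := E 2 0; rewrite !mxE.
- by have := E 2 1; rewrite !mxE.
- by have := E 2 2; rewrite !mxE.
Qed.

Lemma mul_mx33 : A *m B =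
  mx33 (a11 * b11 + a12 * b21 + a13 * b31) (a11 * b12 + a12 * b22 + a13 * b32)
       (a11 * b13 + a12 * b23 + a13 * b33)
       (a21 * b11 + a22 * b21 + a23 * b31) (a21 * b12 + a22 * b22 + a23 * b32)
       (a21 * b13 + a22 * b23 + a23 * b33)
       (a31 * b11 + a32 * b21 + a33 * b31) (a31 * b12 + a32 * b22 + a33 * b32)
       (a31 * b13 + a32 * b23 + a33 * b33).
Proof.
by apply/matrixP; do 2!apply: forall_ord3; rewrite mxE sum_ord3 !mxE.
Qed.

Lemma add_mx33 : A + B =
  mx33 (a11 + b11) (a12 + b12) (a13 + b13) (a21 + b21) (a22 + b22) (a23 + b23)
       (a31 + b31) (a32 + b32) (a33 + b33).
Proof. by apply/matrixP; do 2!apply: forall_ord3; rewrite !mxE. Qed.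

Lemma opp_mx33 :
  - A = mx33 (- a11) (- a12) (- a13) (- a21) (- a22) (- a23)
             (- a31) (- a32) (- a33).
Proof. by apply/matrixP; do 2!apply: forall_ord3; rewrite !mxE. Qed.

Lemma scale_mx33 c :
  c *: A = mx33 (c * a11) (c * a12) (c * a13) (c * a21) (c * a22) (c * a23)
                (c * a31) (c * a32) (c * a33).
Proof. by apply/matrixP; do 2!apply: forall_ord3; rewrite !mxE. Qed.

Lemma tr_mx33 : A^T = mx33 a11 a21 a31 a12 a22 a32 a13 a23 a33.
Proof. by apply/matrixP; do 2!apply: forall_ord3; rewrite !mxE. Qed.

Lemma trace_mx33 : \tr A = a11 + a22 + a33.
Proof. by rewrite /mxtrace sum_ord3 !mxE. Qed.

End Operations.

Lemma mx33_0 : 0 = mx33 0 0 0 0 0 0 0 0 0 :> 'M[R]_3.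
Proof. by apply/matrixP; do 2!apply: forall_ord3; rewrite !mxE. Qed.

Definition mx33E := (mul_mx33, opp_mx33, add_mx33, scale_mx33, tr_mx33,
  trace_mx33, mx33_0).

(** * Lorentz isometries and the Einstein equations for forms *)

(** The Gram matrix of [eps * g] in an adapted basis, for either sign of [eps]. *)
Definition lorentz : 'M[R]_3 := mx33 (-1) 0 0 0 1 0 0 0 1.
Local Notation J := lorentz.

Definition isometry_mx M := M^T *m J *m M = J.

Lemma lorentz_sqr : J *m J = 1%:M.
Proof.
apply/matrixP; do 2!apply: forall_ord3;
  by rewrite /J !mx33E !mxE /=; ring.
Qed.

Lemma isometry_mx_tr M : isometry_mx M -> M *m J *m M^T = J.
Proof.
move=> isoM; have : (J *m M^T *m J) *m M = 1%:M.
  by rewrite -!mulmxA (mulmxA M^T) isoM lorentz_sqr.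
move/mulmx1C => /(congr1 (mulmx^~ J)).
by rewrite mul1mx -!mulmxA lorentz_sqr mulmx1.
Qed.

Lemma isometry_mx_mul M N :
  isometry_mx M -> isometry_mx N -> isometry_mx (M *m N).
Proof.
move=> hM hN; rewrite /isometry_mx trmx_mul mulmxA.
by rewrite -(mulmxA N^T M^T) -(mulmxA N^T) hM.
Qed.

(* For b = F^T J, w = W^T J with J-symmetric part s and J-skew part k of F,
   these are [s, k] = W^2 / 2, {s, W} + [k, W] = 0 and tr s^2 = 0. *)
Definition einstein_mx (b w : 'M[R]_3) :=
  [/\ b *m J *m b^T - b^T *m J *m b = w *m J *m w,
      b^T *m J *m w + w *m J *m b = 0 &
      \tr ((b + b^T) *m J *m (b + b^T) *m J) = 0].

(** Since [M *m J *m M^T = J], two congruent forms multiplied with [J] between them give a congruent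
    form. The last [J] of the trace is absorbed after a cyclic permutation. *)
Lemma einstein_mx_conj M b w : isometry_mx M ->
  einstein_mx b w -> einstein_mx (M^T *m b *m M) (M^T *m w *m M).
Proof.
move=> /isometry_mx_tr isoM [e1 e2 e3].
have mulJ x y : (M^T *m x *m M) *m J *m (M^T *m y *m M) =
    M^T *m (x *m J *m y) *m M.
  by rewrite -{2}isoM !mulmxA.
split; rewrite ?trmx_mul ?trmxK ?(mulmxA M^T) ?mulJ.
- by rewrite -mulmxBl -mulmxBr e1.
- by rewrite -mulmxDl -mulmxDr e2 mulmx0 mul0mx.
- rewrite -mulmxDl -mulmxDr mulJ; move: e3; move: ((b + _) *m _ *m _) => X e3.
  by rewrite -!mulmxA mxtrace_mulC -mulmxA isoM.
Qed.

(** The sign in [w] comes from [eps = - g X X] in signature (2,2): for (vi), the value of H at X,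
    e_1, e_2 is [g X X * a], and [eps] times it is [- a]. *)
Definition normal_form (F w : 'M[R]_3) :=
  [\/ w = 0 /\ exists s : R,
        F = mx33 0 0 (-1 + s) 0 0 (-1 - s) (-1 + s) (1 + s) 0,
      w = 0 /\ exists alpha a : R, (alpha, a) <> (0, 0) /\
        let beta := Num.sqrt (alpha ^+ 2 + a ^+ 2 / 2) in
        F = mx33 alpha (- beta) 0 beta alpha 0 0 0 a,
      w = 0 /\ exists epsilon v : R, (epsilon = -1 \/ epsilon = 1) /\
        F = mx33 (epsilon / 2) (epsilon / 2) v
                 (- (epsilon / 2)) (- (epsilon / 2)) (- v) v v 0 |
      exists a : R, w = mx33 0 (- a) 0 a 0 a 0 (- a) 0 /\
        F = (Num.sqrt 2)^-1 *: mx33 0 (-1 - a ^+ 2 / 2) 0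
              (1 - a ^+ 2 / 2) 0 (1 - a ^+ 2 / 2) 0 (1 + a ^+ 2 / 2) 0].

Definition classifiable b w :=
  exists M F, [/\ isometry_mx M, M^T *m b *m M = F^T *m J &
                  normal_form F (M^T *m w *m M)].

Lemma classifiable_conj M b w : isometry_mx M ->
  classifiable (M^T *m b *m M) (M^T *m w *m M) -> classifiable b w.
Proof.
move=> hM [N [F [hN hb hw]]]; exists (M *m N), F; split.
- exact: isometry_mx_mul.
- by rewrite trmx_mul !mulmxA; move: hb; rewrite !mulmxA.
- by rewrite trmx_mul !mulmxA; move: hw; rewrite !mulmxA.
Qed.

Lemma classifiable_conj_eq M b w b' w' : isometry_mx M ->
  M^T *m b *m M = b' -> M^T *m w *m M = w' ->
  classifiable b' w' -> classifiable b w.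
Proof. by move=> hM <- <-; apply: classifiable_conj. Qed.

Definition swap23 : 'M[R]_3 := mx33 1 0 0 0 0 1 0 1 0.

(** Parametrised by the eigenvalues [l] and [l^-1] on the null vectors (1, 1, 0) and (1, -1, 0), so
    that the entries are rational in [l] and negative [l] is allowed. *)
Definition boost12 (l : R) : 'M[R]_3 :=
  mx33 ((l + l^-1) / 2) ((l - l^-1) / 2) 0
       ((l - l^-1) / 2) ((l + l^-1) / 2) 0 0 0 1.

Definition boost13 (l : R) : 'M[R]_3 :=
  mx33 ((l + l^-1) / 2) 0 ((l - l^-1) / 2) 0 1 0
       ((l - l^-1) / 2) 0 ((l + l^-1) / 2).

(* Fixes (1, 0, -1). *)
Definition nullrot (t : R) : 'M[R]_3 :=
  mx33 (1 + t ^+ 2 / 2) (- t) (t ^+ 2 / 2)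
       (- t) 1 (- t) (- (t ^+ 2 / 2)) t (1 - t ^+ 2 / 2).

Definition rot23 (c s : R) : 'M[R]_3 := mx33 1 0 0 0 c (- s) 0 s c.

Definition flip1 : 'M[R]_3 := mx33 (-1) 0 0 0 1 0 0 0 1.

Lemma isometry_swap23 : isometry_mx swap23.
Proof. by rewrite /isometry_mx /J !mx33E; congr mx33; ring. Qed.

Lemma isometry_flip1 : isometry_mx flip1.
Proof. by rewrite /isometry_mx /J !mx33E; congr mx33; ring. Qed.

Lemma isometry_boost12 l : l != 0 -> isometry_mx (boost12 l).
Proof. by move=> l0; rewrite /isometry_mx /J !mx33E; congr mx33; field. Qed.

Lemma isometry_boost13 l : l != 0 -> isometry_mx (boost13 l).
Proof. by move=> l0; rewrite /isometry_mx /J !mx33E; congr mx33; field. Qed.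

Lemma isometry_nullrot t : isometry_mx (nullrot t).
Proof. by rewrite /isometry_mx /J !mx33E; congr mx33; field. Qed.

Lemma isometry_rot23 c s : c ^+ 2 + s ^+ 2 = 1 -> isometry_mx (rot23 c s).
Proof.
by move=> cs; rewrite /isometry_mx /J !mx33E; congr mx33; move: cs; lra.
Qed.

(** * Reduction of the null family and of skew maps *)

(** With p = e^1 + e^3 and q = e^2, the first form is [be] p p + [mu] p q + [nu] q p and the second
    is [a] (q p - p q). A null rotation fixes p and sends q to q - t p; a boost scales p and fixes
    q. If [mu + nu] is not zero, the rotation removes [be] and the boost makes [mu + nu] equal to
    sqrt 2, giving (v) or (vi). Otherwise [a = 0], and a boost normalises [be], giving (iv). *)
Lemma classifiable_null be mu nu a : nu ^+ 2 = mu ^+ 2 + a ^+ 2 ->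
  (be, mu + nu) <> (0, 0) ->
  classifiable (mx33 be mu be nu 0 nu be mu be) (mx33 0 (- a) 0 a 0 a 0 (- a) 0).
Proof.
move=> numu nz; have [mn0|mn0] := eqVneq (mu + nu) 0.
  have be0 : be != 0 by apply/eqP => be0; apply: nz; rewrite be0 mn0.
  have a0 : a = 0.
    apply/eqP; rewrite -sqrf_eq0; apply/eqP.
    by rewrite -[RHS](mulr0 (nu - mu)) -mn0; move: numu; lra.
  have nE : nu = - mu by move: mn0; lra.
  rewrite {}a0 {}nE oppr0 {nz numu mn0}.
  (* The form (iv) has (1, -1, 0) in its kernel instead of (1, 0, -1). *)
  apply: (classifiable_conj isometry_swap23).
  (* The boost multiplies [be] by [l ^+ 2], which has to become 1/2 up to sign. *)
  pose l := Num.sqrt (2 * `|be|)^-1.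
  have be1 : 0 < `|be| by rewrite normr_gt0.
  have l2 : l ^+ 2 = (2 * `|be|)^-1 by rewrite sqr_sqrtr // invr_ge0; lra.
  have l0 : l != 0 by rewrite -sqrf_eq0 l2 invr_eq0; lra.
  apply: (classifiable_conj (isometry_boost12 l0)).
  have [eps [heps eb]] : exists eps, (eps = -1 \/ eps = 1) /\ - eps * `|be| = be.
    case: (ltrgt0P be) be0 => // _ _.
      by exists (-1); split; [left|ring].
    by exists 1; split; [right|ring].
  have bl : be * l ^+ 2 = - (eps / 2).
    by rewrite l2 -{1}eb; field; lra.
  have II : isometry_mx (1%:M) by rewrite /isometry_mx trmx1 mul1mx mulmx1.
  exists 1%:M; exists (mx33 (eps / 2) (eps / 2) (l * mu)
                 (- (eps / 2)) (- (eps / 2)) (- (l * mu)) (l * mu) (l * mu) 0).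
  rewrite !trmx1 !mul1mx !mulmx1; split=> //.
    have -> : eps / 2 = - (be * l ^+ 2) by rewrite bl opprK.
    by rewrite /J !mx33E; congr mx33; field.
  apply: Or43; split; first by rewrite !mx33E; congr mx33; ring.
  by exists eps, (l * mu).
have r0 : Num.sqrt 2 != 0 :> R by rewrite lt0r_neq0 // sqrtr_gt0; lra.
have r2 : Num.sqrt 2 ^+ 2 = 2 :> R by rewrite sqr_sqrtr; lra.
apply: (classifiable_conj (isometry_nullrot (be / (mu + nu)))).
have l0 : Num.sqrt 2 / (mu + nu) != 0 by rewrite mulf_neq0 ?invr_neq0.
apply: (classifiable_conj (isometry_boost13 l0)).
have II : isometry_mx (1%:M) by rewrite /isometry_mx trmx1 mul1mx mulmx1.
exists 1%:M; eexists; rewrite !trmx1 !mul1mx !mulmx1; split=> //; last first.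
  apply: Or44; exists (a * Num.sqrt 2 / (mu + nu)); split.
    by rewrite !mx33E; congr mx33; field; rewrite ?mn0.
  reflexivity.
move: r0 r2 {l0}; move: (Num.sqrt 2) => r r0 r2.
(* So [1 -] and [1 +] this value are [2 * mu / (mu + nu)] and [2 * nu / (mu + nu)], the boosted
   entries up to the factor [r^-1]. *)
have -> : (a * r / (mu + nu)) ^+ 2 / 2 = (nu - mu) / (mu + nu).
  rewrite !exprMn r2 (_ : a ^+ 2 = (nu - mu) * (mu + nu)); first by field.
  by move: numu; lra.
have -> : r^-1 = r / 2 by apply: (mulfI r0); rewrite divff // mulrA -expr2 r2; field.
rewrite /J !mx33E; congr mx33; try (field; by rewrite ?mn0 ?r0).
Qed.

Lemma ex_rotation (x y : R) :
  exists c s, c ^+ 2 + s ^+ 2 = 1 /\ c * x + s * y = 0.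
Proof.
have [xy0|xy0] := eqVneq (x ^+ 2 + y ^+ 2) 0.
  by exists 1, 0; split; first ring; nra.
pose r := Num.sqrt (x ^+ 2 + y ^+ 2).
have r2 : r ^+ 2 = x ^+ 2 + y ^+ 2.
  by rewrite sqr_sqrtr // addr_ge0 ?sqr_ge0.
have r0 : r != 0 by rewrite -sqrf_eq0 r2.
exists (y / r), (- x / r); split; last by field.
by rewrite !expr_div_n sqrrN -mulrDl addrC -r2 divff // sqrf_eq0.
Qed.

(** A rotation of the spacelike plane removes the first component. The boost then divides [v - u] by
    [l] and multiplies [v + u] by [l]: the first becomes 2, and sigma is the invariant
    [(v + u) * (v - u) / 4]. If [u = v], reversing the timelike vector exchanges the roles of
    [v - u] and [v + u]. *)
Lemma classifiable_skew x y z : (x, y, z) <> (0, 0, 0) ->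
  classifiable (mx33 0 x y (- x) 0 z (- y) (- z) 0) 0.
Proof.
have skew_zy u v : v - u != 0 ->
    classifiable (mx33 0 0 u 0 0 v (- u) (- v) 0) 0.
  move=> vu0; have l0 : (v - u) / 2 != 0 by rewrite mulf_neq0 ?invr_neq0 ?pnatr_eq0.
  exists (boost12 ((v - u) / 2)); eexists; split; first exact: isometry_boost12.
    2: by rewrite mulmx0 mul0mx; apply: Or41; split=> //;
      exists ((v + u) * (v - u) / 4).
  by rewrite /J !mx33E; congr mx33; field.
have skew_yz u v : (u, v) <> (0, 0) ->
    classifiable (mx33 0 0 u 0 0 v (- u) (- v) 0) 0.
  move=> uv0; have [vu0|] := eqVneq (v - u) 0; last exact: skew_zy.
  apply: (classifiable_conj_eq isometry_flip1 _ _ (@skew_zy (- u) v _)).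
  - by rewrite !mx33E; congr mx33; ring.
  - by rewrite mulmx0 mul0mx.
  - apply/eqP => uv1; apply: uv0; congr (_, _); lra.
move=> xyz0; have [c [s [cs xy0]]] := ex_rotation x y.
apply: (classifiable_conj_eq (isometry_rot23 cs) _ _
         (@skew_yz (c * y - s * x) z _)).
- have cz : (c ^+ 2 + s ^+ 2) * z = z by rewrite cs mul1r.
  by rewrite !mx33E; congr mx33; lra.
- by rewrite mulmx0 mul0mx.
- case=> yx0 z0; apply: xyz0; congr (_, _, _) => //.
    have -> : x = (c ^+ 2 + s ^+ 2) * x by rewrite cs mul1r.
    rewrite (_ : _ * x = c * (c * x + s * y) - s * (c * y - s * x)); last ring.
    by rewrite xy0 yx0; ring.
  have -> : y = (c ^+ 2 + s ^+ 2) * y by rewrite cs mul1r.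
  rewrite (_ : _ * y = s * (c * x + s * y) + c * (c * y - s * x)); last ring.
  by rewrite xy0 yx0; ring.
Qed.

(** The first matrix equation is symmetric and the second is skew, so six and three scalar equations
    remain, besides the trace. *)
Lemma einstein_mxP b11 b12 b13 b21 b22 b23 b31 b32 b33 x y z :
  einstein_mx (mx33 b11 b12 b13 b21 b22 b23 b31 b32 b33)
              (mx33 0 x y (- x) 0 z (- y) (- z) 0) <->
  [/\ [/\ b12 ^+ 2 + b13 ^+ 2 - b21 ^+ 2 - b31 ^+ 2 = - x ^+ 2 - y ^+ 2,
          b12 ^+ 2 + b23 ^+ 2 - b21 ^+ 2 - b32 ^+ 2 = x ^+ 2 - z ^+ 2 &
          b13 ^+ 2 + b32 ^+ 2 - b31 ^+ 2 - b23 ^+ 2 = y ^+ 2 - z ^+ 2],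
      [/\ (b11 + b22) * (b12 - b21) + b13 * b23 - b31 * b32 = - (y * z),
          (b11 + b33) * (b13 - b31) + b12 * b32 - b21 * b23 = x * z &
          (b22 - b33) * (b32 - b23) + b12 * b13 - b21 * b31 = x * y],
      [/\ (b22 - b11) * x + b32 * y - b31 * z = 0,
          b23 * x + (b33 - b11) * y + b21 * z = 0 &
          b13 * x - b12 * y + (b22 + b33) * z = 0] &
      2 * (b11 ^+ 2 + b22 ^+ 2 + b33 ^+ 2) + (b23 + b32) ^+ 2 =
      (b12 + b21) ^+ 2 + (b13 + b31) ^+ 2].
Proof.
rewrite /einstein_mx /J !mx33E; split.
  case=> /mx33_inj[[e11 e12 e13] [_ e22 e23] [_ _ e33]].
  move=> /mx33_inj[[_ d12 d13] [_ _ d23] _] tr0.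
  by split; [split|split|split|]; lra.
move=> [[e11 e22 e33] [e12 e13 e23] [d12 d13 d23] tr0].
by split; [congr mx33; lra|congr mx33; lra|lra].
Qed.

End Matrices33.

(** * Classification of the solutions by type of [w] and of the symmetric part *)

Section Classification.
Variable R : realType.
Implicit Types (M N : 'M[R]_3).
Local Notation J := (lorentz R).

(** As [a] is not zero, the equations linear in [w] determine three entries of [b]. After that tr
    s^2 is a sum of squares, and combinations of the quadratic equations are single squares; what
    survives is the family of [classifiable_null]. *)
Lemma classifiable_twisted (b : 'M[R]_3) (a : R) : a != 0 ->
  einstein_mx b (mx33 0 (- a) 0 a 0 a 0 (- a) 0) ->
  classifiable b (mx33 0 (- a) 0 a 0 a 0 (- a) 0).
Proof.
rewrite (eta_mx33 b).
move: (b 0 0) (b 0 1) (b 0 2) (b 1 0) (b 1 1) (b 1 2) (b 2 0) (b 2 1) (b 2 2).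
move=> b11 b12 b13 b21 b22 b23 b31 b32 b33 a0.
have := einstein_mxP b11 b12 b13 b21 b22 b23 b31 b32 b33 (- a) 0 a.
rewrite opprK oppr0 sqrrN expr0n /= => -[+ _] => /[apply].
case=> [[e11 e22 e33] [e12 e13 e23] [d12 d13 d23] tr0].
have h1 : b21 = b23 by apply: (mulfI a0); lra.
have h2 : b11 = b22 + b31 by apply: (mulfI a0); lra.
have h3 : b13 = b22 + b33 by apply: (mulfI a0); lra.
have h4 : b12 = b32.
  apply/eqP; rewrite -subr_eq0 -sqrf_eq0; apply/eqP; subst.
  by move: e11 e13 e33; clear; lra.
subst b11 b12 b13 b21.
have h5 : b22 = 0.
  have : (b22 + b31 - b33) ^+ 2 + (b22 ^+ 2 + b22 ^+ 2) = 0.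
    by move: tr0; clear; lra.
  move/eqP; rewrite !paddr_eq0 ?addr_ge0 ?sqr_ge0 // !sqrf_eq0.
  by case/and3P => _ _ /eqP.
subst b22; have h6 : b31 = b33.
  by apply/eqP; rewrite -subr_eq0 -sqrf_eq0; apply/eqP; lra.
subst b31; rewrite !add0r; apply: classifiable_null; first by lra.
case=> _ mn0; move/eqP: a0; apply; apply/eqP; rewrite -sqrf_eq0; apply/eqP.
have -> : a ^+ 2 = (b32 + b23) * (b23 - b32) by lra.
by rewrite mn0 mul0r.
Qed.

Lemma classifiable_skew_neq0 (b : 'M[R]_3) (x y z : R) : (x, y, z) <> (0, 0, 0) ->
  einstein_mx b (mx33 0 x y (- x) 0 z (- y) (- z) 0) ->
  classifiable b (mx33 0 x y (- x) 0 z (- y) (- z) 0).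
Proof.
move=> xyz0 einb.
have zE : z ^+ 2 = x ^+ 2 + y ^+ 2.
  by move: einb; rewrite (eta_mx33 b) => /einstein_mxP[[e11 e22 e33] _ _ _]; lra.
have z0 : z != 0.
  apply/eqP => z0; apply: xyz0.
  have := esym zE; rewrite {}z0 expr0n /= => /eqP.
  by rewrite paddr_eq0 ?sqr_ge0 // !sqrf_eq0 => /andP[/eqP-> /eqP->].
(* The kernel of [w] is spanned by (1, - y / z, x / z), the image of (1, 0, -1) under the rotation
   with this cosine and sine. *)
have cs : (- x / z) ^+ 2 + (- y / z) ^+ 2 = 1.
  by rewrite !expr_div_n !sqrrN -mulrDl -zE divff // sqrf_eq0.
have isoA := isometry_rot23 cs.
have := einstein_mx_conj isoA einb => {}einb.
apply: (classifiable_conj isoA); move: einb; move: (_ *m b *m _) => {}b.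
rewrite (_ : _^T *m _ *m _ = mx33 0 (- z) 0 z 0 z 0 (- z) 0).
  exact: classifiable_twisted.
by rewrite !mx33E; congr mx33; field: zE.
Qed.

Lemma mx33_skew0 : 0 = mx33 0 0 0 (- 0) 0 0 (- 0) (- 0) 0 :> 'M[R]_3.
Proof. by rewrite oppr0 mx33_0. Qed.

(** Here s has the eigenvalue [E] and a complex pair with real part [- A] and imaginary parts plus
    and minus [B]. The skew part commutes with s, so it cannot mix the two eigenspaces, and on the
    Lorentzian plane of the pair only the zero skew map commutes with a rotation. Hence f = s, and
    tr s^2 = 0 determines beta. *)
Lemma classifiable_complex (A B E x y z : R) : B != 0 ->
  einstein_mx (mx33 A (B + x) y (B - x) (- A) z (- y) (- z) E) 0 ->
  classifiable (mx33 A (B + x) y (B - x) (- A) z (- y) (- z) E) 0.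
Proof.
move=> B0; rewrite {1}mx33_skew0 => /einstein_mxP[].
move=> [e11 e22 e33] [e12 e13 e23] _ tr0.
have x0 : x = 0 by apply: (mulfI B0); move: e11 e22 e33; clear; lra.
subst x.
have hz : A * y + E * y = B * z by move: e13; clear; lra.
have hy : B * y = - A * z - E * z by move: e23; clear; lra.
have trE : E ^+ 2 + 2 * A ^+ 2 = 2 * B ^+ 2 by move: tr0; clear; lra.
have yz0 u v : A * u + E * u = B * v -> B * u = - A * v - E * v -> v = 0.
  (* The factor is the squared distance between the real eigenvalue [E] and the complex pair. *)
  move=> hv hu; have h : (B ^+ 2 + (A + E) ^+ 2) * v = 0.
    rewrite (_ : _ * v = B * (B * v) + (A + E) * (A * v + E * v)); last ring.
    by rewrite -hv -[A * v + _]opprK opprD -mulNr -hu; ring.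
  move/eqP: h; rewrite mulf_eq0 paddr_eq0 ?sqr_ge0 // !sqrf_eq0.
  by rewrite (negPf B0) => /eqP.
have z0 : z = 0 by apply: (yz0 y).
have y0 : y = 0 by apply: (mulfI B0); rewrite hy z0; ring.
subst y z => {hz hy e11 e22 e33 e12 e13 e23 tr0}.
have pos u : 0 < u -> E ^+ 2 + 2 * A ^+ 2 = 2 * u ^+ 2 ->
    classifiable (mx33 A u 0 u (- A) 0 0 0 E) 0.
  move=> u0 uE; have II : isometry_mx (1%:M : 'M[R]_3).
    by rewrite /isometry_mx trmx1 mul1mx mulmx1.
  exists 1%:M; eexists; rewrite !trmx1 !mul1mx !mulmx1; split=> //; last first.
    apply: Or42; split=> //; exists (- A), E; split; last by [].
    by case=> /eqP; rewrite oppr_eq0 => /eqP A0 E0; move: uE u0; rewrite A0 E0; nra.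
  have -> : Num.sqrt ((- A) ^+ 2 + E ^+ 2 / 2) = u.
    rewrite (_ : _ + _ = u ^+ 2) ?sqrtr_sqr ?gtr0_norm //.
    by move: uE; clear; lra.
  by rewrite /J !mx33E; congr mx33; ring.
rewrite !(addr0, subr0, oppr0).
have [B1|B1|B1] := ltrgt0P B; first exact: pos.
  apply: (classifiable_conj_eq (isometry_flip1 R) _ _ (pos (- B) _ _)).
  - by rewrite !mx33E; congr mx33; ring.
  - by rewrite mulmx0 mul0mx.
  - by rewrite oppr_gt0.
  - by rewrite sqrrN.
by rewrite B1 eqxx in B0.
Qed.

(** Here s is nilpotent of rank one, and a skew map that commutes with it generates null rotations
    about the same null vector. Exchanging the spacelike vectors leads to [classifiable_null] with
    [mu + nu = 0], hence to (iv). *)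
Lemma classifiable_degenerate (A x y z : R) : A != 0 ->
  einstein_mx (mx33 A (A + x) y (A - x) A z (- y) (- z) 0) 0 ->
  classifiable (mx33 A (A + x) y (A - x) A z (- y) (- z) 0) 0.
Proof.
move=> A0; rewrite {1}mx33_skew0 => /einstein_mxP[].
move=> [e11 e22 e33] [e12 e13 e23] _ _.
have x0 : x = 0 by apply: (mulfI A0); move: e11 e22 e33; clear; lra.
have yz : y = z by apply: (mulfI A0); move: e13 e23; rewrite x0; clear; lra.
subst x y.
apply: (classifiable_conj_eq (isometry_swap23 R) _ _
          (@classifiable_null _ A z (- z) 0 _ _)).
- by rewrite !mx33E; congr mx33; ring.
- by rewrite mulmx0 mul0mx oppr0 mx33_0.
- by rewrite sqrrN expr0n addr0.
- by case=> /eqP; rewrite (negPf A0).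
Qed.

(** The third basis vector is a spacelike eigenvector of s. On its orthogonal Lorentzian plane s is
    nilpotent or has a complex pair of eigenvalues: tr s^2 = 0 excludes two distinct real ones. *)
Lemma classifiable_spacelike (A B D E x y z : R) : (A, B, D, E) <> (0, 0, 0, 0) ->
  einstein_mx (mx33 A (B + x) y (B - x) D z (- y) (- z) E) 0 ->
  classifiable (mx33 A (B + x) y (B - x) D z (- y) (- z) E) 0.
Proof.
move=> nz ein; have trE : A ^+ 2 + D ^+ 2 + E ^+ 2 = 2 * B ^+ 2.
  by move: ein; rewrite {1}mx33_skew0 => /einstein_mxP[_ _ _]; clear; lra.
have B0 : B != 0.
  apply/eqP => B0; apply: nz; move/eqP: trE.
  rewrite B0 expr0n mulr0 /= !paddr_eq0 ?addr_ge0 ?sqr_ge0 // !sqrf_eq0.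
  by case/andP=> /andP[/eqP-> /eqP->] /eqP->.
(* By tr s^2 = 0 this is minus the discriminant of s on the plane of the first
   two basis vectors. *)
have [discr0|discr0] := eqVneq ((A - D) ^+ 2 + (E ^+ 2 + E ^+ 2)) 0.
  have [DA E0] : D = A /\ E = 0.
    move/eqP: discr0; rewrite !paddr_eq0 ?addr_ge0 ?sqr_ge0 //.
    by rewrite !sqrf_eq0 subr_eq0 andbb => /andP[/eqP-> /eqP->].
  subst D E; have : (A == B) || (A == - B).
    by rewrite -eqf_sqr; apply/eqP; move: trE; clear; lra.
  case/orP => /eqP AB; first by subst B; apply: classifiable_degenerate.
  have isoF := isometry_flip1 R.
  have conjE : (flip1 R)^T *m mx33 A (B + x) y (B - x) A z (- y) (- z) 0 *m flip1 R
    = mx33 A (A + - x) (- y) (A - - x) A z (- - y) (- z) 0.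
    by rewrite AB !mx33E; congr mx33; ring.
  apply: (classifiable_conj_eq isoF conjE); first by rewrite mulmx0 mul0mx.
  apply: classifiable_degenerate; first by rewrite AB oppr_eq0.
  by rewrite -conjE; have := einstein_mx_conj isoF ein; rewrite mulmx0 mul0mx.
have discr_gt0 : 0 < (2 * B - (A + D)) * (2 * B + (A + D)).
  rewrite (_ : _ * _ = (A - D) ^+ 2 + (E ^+ 2 + E ^+ 2)); last by move: trE; clear; lra.
  by rewrite lt0r discr0 addr_ge0 ?addr_ge0 ?sqr_ge0.
(* The boost multiplies the values [2 * B + (A + D)] and [A + D - 2 * B] of the form of s at (1, 1,
   0) and (1, -1, 0) by [l ^+ 2] and [l ^- 2]. This fourth root makes their sum vanish, so that the
   new diagonal entries on the plane are opposite. *)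
have [l l0 lE] : exists2 l, l != 0 &
    l ^+ 4 * (2 * B + (A + D)) = 2 * B - (A + D).
  move: discr_gt0; move: (2 * B + _) (2 * B - _) => u v uv.
  have u0 : u != 0 by apply: contraTneq uv => ->; rewrite mulr0 ltxx.
  have vu : 0 < v / u.
    by rewrite (_ : v / u = v * u / u ^+ 2) ?divr_gt0 ?exprn_even_gt0 //; field.
  exists (Num.sqrt (Num.sqrt (v / u))).
    by rewrite lt0r_neq0 // !sqrtr_gt0.
  by rewrite (exprM _ 2 2) !sqr_sqrtr ?sqrtr_ge0 ?ltW // divfK.
have isoL := isometry_boost12 l0.
have u0 : 2 * B + (A + D) != 0.
  by apply: contraTneq discr_gt0 => ->; rewrite mulr0 ltxx.
move: u0 lE {discr_gt0}; set u := 2 * B + (A + D); set d := (A - D) / 2 => u0 lE.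
(* Expressing [A], [B], [D] by [l], [u], [d] builds in the relation that defines [l], so the
   conjugation below becomes an identity of rational functions. *)
have BE : B = (1 + l ^+ 4) * u / 4 by rewrite mulrDl lE /u; field.
have AE : A = (1 - l ^+ 4) * u / 4 + d by rewrite mulrBl lE /u /d; field.
have DE : D = (1 - l ^+ 4) * u / 4 - d by rewrite mulrBl lE /u /d; field.
move: ein; clearbody u d; rewrite {}AE {}BE {}DE {nz trE discr0 B0 lE A B D} => ein.
have conjE :
    (boost12 l)^T *m mx33 ((1 - l ^+ 4) * u / 4 + d) ((1 + l ^+ 4) * u / 4 + x) y
      ((1 + l ^+ 4) * u / 4 - x) ((1 - l ^+ 4) * u / 4 - d) z (- y) (- z) E
      *m boost12 l =
    mx33 d (l ^+ 2 * u / 2 + x) ((l + l^-1) / 2 * y + (l - l^-1) / 2 * z)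
         (l ^+ 2 * u / 2 - x) (- d) ((l - l^-1) / 2 * y + (l + l^-1) / 2 * z)
         (- ((l + l^-1) / 2 * y + (l - l^-1) / 2 * z))
         (- ((l - l^-1) / 2 * y + (l + l^-1) / 2 * z)) E.
  by rewrite !mx33E; congr mx33; field.
apply: (classifiable_conj_eq isoL conjE); first by rewrite mulmx0 mul0mx.
apply: classifiable_complex; first by rewrite !mulf_neq0 ?expf_neq0 ?invr_neq0
  ?pnatr_eq0.
by rewrite -conjE; have := einstein_mx_conj isoL ein; rewrite mulmx0 mul0mx.
Qed.

(** The three equations say that (1, 0, -1) is an eigenvector of s with eigenvalue [a]. A null
    eigenvector makes its eigenvalue double, so tr s^2 is [2 * a ^+ 2 + D ^+ 2] and s is nilpotent.
    The commuting skew part then has the same null vector in its kernel, and [b] belongs to the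
    family of [classifiable_null]. *)
Lemma classifiable_null_eigen (A B C D G E x y z a : R) :
  (A, B, C, D, G, E) <> (0, 0, 0, 0, 0, 0) ->
  B = G -> A - C = - a -> C - E = - a ->
  einstein_mx (mx33 A (B + x) (C + y) (B - x) D (G + z) (C - y) (G - z) E) 0 ->
  classifiable (mx33 A (B + x) (C + y) (B - x) D (G + z) (C - y) (G - z) E) 0.
Proof.
move=> nz BG AC CE; rewrite {1}mx33_skew0 => /einstein_mxP[].
move=> [e11 e22 e33] [e12 e13 e23] _ tr0.
have AE : A = C - a by move: AC; clear; lra.
have EE : E = C + a by move: CE; clear; lra.
subst A E G; have [a0 D0] : a = 0 /\ D = 0.
  have : (a ^+ 2 + a ^+ 2) + D ^+ 2 = 0 by move: tr0; clear; lra.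
  move/eqP; rewrite !paddr_eq0 ?addr_ge0 ?sqr_ge0 // !sqrf_eq0 andbb.
  by case/andP=> /eqP-> /eqP->.
subst a D; rewrite !(addr0, subr0) in nz e11 e22 e33 e12 e13 e23 *.
have [y0 zE Bx] : [/\ y = 0, z = - x & B * x = 0].
  have [B0|B0] := eqVneq B 0.
    have C0 : C != 0 by apply/eqP => C0; apply: nz; rewrite B0 C0.
    subst B; rewrite !(add0r, sub0r, sqrrN) in e11 e22 e33 e12 e13 e23.
    split; last by rewrite mul0r.
      apply: (mulfI C0); move: e11; clear; lra.
    apply: (mulfI C0); move: e12; clear; lra.
  have zE : z = - x by apply: (mulfI B0); move: e22; clear; lra.
  have y0 : y = 0 by apply: (mulfI B0); move: e12; rewrite zE; clear; lra.
  by split=> //; move: e11; rewrite y0; clear; lra.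
subst y z; rewrite mx33_skew0.
have -> : mx33 C (B + x) (C + 0) (B - x) 0 (B + - x) (C - 0) (B - - x) C =
    mx33 C (B + x) C (B - x) 0 (B - x) C (B + x) C by congr mx33; ring.
have -> : mx33 0 0 0 (- 0) 0 0 (- 0) (- 0) 0 = mx33 0 (- 0) 0 0 0 0 0 (- 0) 0 :>
  'M[R]_3.
  by congr mx33; ring.
apply: classifiable_null; first by rewrite expr0n /=; move: Bx; clear; lra.
case=> C0 B0; apply: nz; rewrite C0; congr (_, _, _, _, _, _); move: B0; clear; lra.
Qed.

(** * A real eigenvector, and the isometries that move it to a standard position *)

Lemma monic_cubic_root (p : {poly R}) : p \is monic -> size p = 4 -> exists x, root p x.
Proof.
move=> /monicP; rewrite lead_coefE => + sp; rewrite sp /= => p3.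
have pE x : p.[x] = x ^+ 3 + (p`_2 * x ^+ 2 + p`_1 * x + p`_0).
  by rewrite horner_coef sp !big_ord_recl big_ord0 /= p3; ring.
(* A Cauchy bound: at [m] and [- m] the lower terms are at most [m ^+ 3] in absolute value, so the
   cubic term decides the sign. *)
pose m := 1 + (`|p`_2| + `|p`_1| + `|p`_0|).
have m1 : 1 <= m by rewrite lerDl !addr_ge0.
have bound x : `|x| = m -> `|p`_2 * x ^+ 2 + p`_1 * x + p`_0| <= m ^+ 3.
  move=> xm; have m2 : m <= m ^+ 2 by rewrite expr2 ler_peMl // (le_trans ler01).
  apply: le_trans (_ : (`|p`_2| + `|p`_1| + `|p`_0|) * m ^+ 2 <= _).
    rewrite !mulrDl; apply: le_trans (ler_normD _ _) _.
    rewrite lerD //; last first.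
      by rewrite ler_peMr // (le_trans m1).
    apply: le_trans (ler_normD _ _) _.
    by rewrite normrM normrX (normrM _ x) xm lerD // ler_wpM2l.
  rewrite (exprS m 2) ler_wpM2r ?sqr_ge0 //.
  by rewrite /m lerDr.
have [||x _ px] := @poly_ivt R p (- m) m; first by rewrite ge0_cp // (le_trans ler01).
  have mm : `|m| = m by rewrite ger0_norm // (le_trans ler01).
  have := bound m mm; have := bound (- m); rewrite normrN => /(_ mm).
  rewrite !ler_norml => /andP[_ h1] /andP[h2 _]; rewrite !pE.
  by apply/andP; split; [move: h1|move: h2]; clear; lra.
by exists x.
Qed.

Lemma mx33_eigenvector (M : 'M[R]_3) :
  exists a, exists2 x : 'rV_3, x *m M = a *: x & x != 0.
Proof.
have [||a] := @monic_cubic_root (char_poly M).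
- exact: char_poly_monic.
- by rewrite size_char_poly.
by rewrite -eigenvalue_root_char => /eigenvalueP; exists a.
Qed.

(** Unless [x] is the first basis vector, the witness is the reflection exchanging the two; their
    difference has square [2 * (x1 - 1)]. *)
Lemma isometry_timelike (x : 'rV[R]_3) :
  - x 0 0 ^+ 2 + x 0 1 ^+ 2 + x 0 2 ^+ 2 = -1 ->
  exists2 A, isometry_mx A & 'e_0 *m A^T = x.
Proof.
have eta_x : x = \row_j nth 0 [:: x 0 0; x 0 1; x 0 2] j.
  by apply/rowP; apply: forall_ord3; rewrite mxE.
rewrite {4}eta_x; move: (x 0 0) (x 0 1) (x 0 2) => x1 x2 x3 xE.
have [x10|x10] := eqVneq x1 1.
  have /eqP : x2 ^+ 2 + x3 ^+ 2 = 0 by move: xE; rewrite x10; clear; lra.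
  rewrite paddr_eq0 ?sqr_ge0 // !sqrf_eq0 => /andP[/eqP-> /eqP->].
  exists 1%:M; first by rewrite /isometry_mx trmx1 mul1mx mulmx1.
  by rewrite trmx1 mulmx1 x10; apply/rowP; apply: forall_ord3; rewrite !mxE.
have x11 : x1 - 1 != 0 by rewrite subr_eq0.
exists (mx33 x1 (- x2) (- x3) x2 (1 - x2 ^+ 2 / (x1 - 1)) (- (x2 * x3 / (x1 - 1)))
   x3 (- (x2 * x3 / (x1 - 1))) (1 - x3 ^+ 2 / (x1 - 1))).
  have x1E : x1 ^+ 2 = x2 ^+ 2 + x3 ^+ 2 + 1 by move: xE; clear; lra.
  rewrite /isometry_mx /J !mx33E; congr mx33; field: x1E; by rewrite ?x11.
by rewrite tr_mx33 -rowE; apply/rowP; apply: forall_ord3; rewrite !mxE.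
Qed.

(** Again a reflection, exchanging [x] with the last basis vector. Their difference can be null
    without being zero; [x 0 2 != 1] rules this out. *)
Lemma isometry_spacelike (x : 'rV[R]_3) :
  - x 0 0 ^+ 2 + x 0 1 ^+ 2 + x 0 2 ^+ 2 = 1 -> x 0 2 != 1 ->
  exists2 A, isometry_mx A & 'e_2 *m A^T = x.
Proof.
have eta_x : x = \row_j nth 0 [:: x 0 0; x 0 1; x 0 2] j.
  by apply/rowP; apply: forall_ord3; rewrite mxE.
rewrite {5}eta_x; move: (x 0 0) (x 0 1) (x 0 2) => x1 x2 x3 xE.
rewrite -subr_eq0 => x31.
exists (mx33 (1 - x1 ^+ 2 / (x3 - 1)) (x1 * x2 / (x3 - 1)) x1
   (- (x1 * x2 / (x3 - 1))) (1 + x2 ^+ 2 / (x3 - 1)) x2 (- x1) x2 x3).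
  have x1E : x1 ^+ 2 = x2 ^+ 2 + x3 ^+ 2 - 1 by move: xE; clear; lra.
  rewrite /isometry_mx /J !mx33E; congr mx33; field: x1E; by rewrite ?x31.
by rewrite tr_mx33 -rowE; apply/rowP; apply: forall_ord3; rewrite !mxE.
Qed.

Lemma isometry_null (x : 'rV[R]_3) :
  - x 0 0 ^+ 2 + x 0 1 ^+ 2 + x 0 2 ^+ 2 = 0 -> x 0 0 = 1 ->
  exists2 A, isometry_mx A & ('e_0 - 'e_2) *m A^T = x.
Proof.
have eta_x : x = \row_j nth 0 [:: x 0 0; x 0 1; x 0 2] j.
  by apply/rowP; apply: forall_ord3; rewrite mxE.
rewrite {5}eta_x; move: (x 0 0) (x 0 1) (x 0 2) => x1 x2 x3 xE x1E.
exists (rot23 (- x3) x2).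
  by apply: isometry_rot23; move: xE; rewrite x1E; clear; lra.
rewrite tr_mx33 mulmxBl -!rowE x1E; apply/rowP; apply: forall_ord3;
  by rewrite !mxE /=; ring.
Qed.

Lemma isometry_mx_eq0 (A b : 'M[R]_3) :
  isometry_mx A -> A^T *m b *m A = 0 -> b = 0.
Proof.
move=> /isometry_mx_tr isoA b0.
have : J *m b *m J = 0.
  have -> : J *m b *m J = A *m J *m (A^T *m b *m A) *m J *m A^T.
    by rewrite -[in LHS]isoA !mulmxA.
  by rewrite b0 !(mul0mx, mulmx0).
move=> /(congr1 (fun M => J *m M *m J)); rewrite mulmx0 mul0mx.
by rewrite !mulmxA lorentz_sqr mul1mx -mulmxA lorentz_sqr mulmx1.
Qed.

Lemma eigenform_conj (S A : 'M[R]_3) (x c : 'rV_3) a :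
  isometry_mx A -> c *m A^T = x -> x *m S = a *: (x *m J) ->
  c *m (A^T *m S *m A) = a *: (c *m J).
Proof.
move=> isoA cA xS.
by rewrite !mulmxA cA xS -cA -scalemxAl -!mulmxA (mulmxA A^T) isoA.
Qed.

Lemma classifiable_zero (b : 'M[R]_3) :
  b != 0 -> einstein_mx b 0 -> classifiable b 0.
Proof.
move=> b0 einb.
(* Transposed, [x] is an eigenvector of [J *m (b + b^T)], which is twice the symmetric part s
   because [b = F^T *m J]. *)
have [a [x xSJ x0]] := mx33_eigenvector ((b + b^T) *m J).
have {xSJ} xS : x *m (b + b^T) = a *: (x *m J).
  by rewrite scalemxAl -xSJ -!mulmxA lorentz_sqr mulmx1.
have conjb A c k : isometry_mx A -> c *m A^T = k *: x ->
    [/\ einstein_mx (A^T *m b *m A) 0, A^T *m b *m A != 0 &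
       c *m ((A^T *m b *m A) + (A^T *m b *m A)^T) = a *: (c *m J)].
  move=> isoA cA; split.
  - by have := einstein_mx_conj isoA einb; rewrite mulmx0 mul0mx.
  - by apply: contra_neq b0; apply: isometry_mx_eq0.
  - have -> : A^T *m b *m A + (A^T *m b *m A)^T = A^T *m (b + b^T) *m A.
      by rewrite !trmx_mul trmxK mulmxA mulmxDr mulmxDl.
    by apply: (eigenform_conj isoA cA); rewrite -!scalemxAl xS !scalerA mulrC.
have conjC A : isometry_mx A -> classifiable (A^T *m b *m A) 0 -> classifiable b 0.
  by move=> isoA; apply: (classifiable_conj_eq isoA) => //; rewrite mulmx0 mul0mx.
have skewC (m : 'M[R]_3) : m != 0 -> m + m^T = 0 -> classifiable m 0.
  move=> m0 ms; have E i j : m i j = - m j i.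
    by apply/eqP; rewrite -addr_eq0; move/matrixP/(_ i j)/eqP: ms; rewrite !mxE.
  have Eii i : m i i = 0 by have := E i i; lra.
  have eqs : m = mx33 0 (m 0 1) (m 0 2) (- m 0 1) 0 (m 1 2) (- m 0 2) (- m 1 2) 0.
    by rewrite {1}(eta_mx33 m) !Eii (E 1 0) (E 2 0) (E 2 1).
  rewrite eqs; apply: classifiable_skew => -[m01' m02' m12'].
  move: m0; rewrite eqs m01' m02' m12' !oppr0 -mx33_0.
  by rewrite eqxx.
pose N (v : 'rV[R]_3) : R := - v 0 0 ^+ 2 + v 0 1 ^+ 2 + v 0 2 ^+ 2.
have NZ k v : N (k *: v) = k ^+ 2 * N v by rewrite /N !mxE; ring.
have [N0|N0|N0] := ltrgt0P (N x).
- have k2 : (Num.sqrt (N x))^-1 ^+ 2 * N x = 1.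
    by rewrite exprVn sqr_sqrtr ?ltW // mulVf // gt_eqF.
  (* Of the two normalised multiples of [x], at least one avoids the value 1 excluded by
     [isometry_spacelike]. *)
  have [k k2' k1] : exists2 k, k ^+ 2 * N x = 1 & (k *: x) 0 2 != 1.
    have [x21|x21] := eqVneq (((Num.sqrt (N x))^-1 *: x) 0 2) 1; last first.
      by exists (Num.sqrt (N x))^-1.
    exists (- (Num.sqrt (N x))^-1); first by rewrite sqrrN.
    by rewrite scaleNr mxE x21; apply/eqP; lra.
  rewrite -NZ in k2'; have [A isoA cA] := isometry_spacelike k2' k1.
  have [einA bA0 eigA] := conjb A _ k isoA cA; apply: (conjC A isoA).
  move: (_ *m b *m A) einA bA0 eigA
    {conjb conjC xS einb b0} => {}b einb b0.
  rewrite -!rowE => /rowP eqr.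
  have b20 : b 2 0 = - b 0 2 by have := eqr 0; rewrite !mxE /=; lra.
  have b21 : b 2 1 = - b 1 2 by have := eqr 1; rewrite !mxE /=; lra.
  pose B := (b 0 1 + b 1 0) / 2; pose y := (b 0 1 - b 1 0) / 2.
  have bE : b = mx33 (b 0 0) (B + y) (b 0 2) (B - y) (b 1 1) (b 1 2)
                  (- b 0 2) (- b 1 2) (b 2 2).
    by rewrite {1}(eta_mx33 b) b20 b21 /B /y; congr mx33; field.
  rewrite bE in einb *.
  have [[A0 B0 D0 E0]|] := eqVneq (b 0 0, B, b 1 1, b 2 2) (0, 0, 0, 0); last first.
    by move/eqP => ne; apply: classifiable_spacelike.
  apply: skewC; first by rewrite -bE.
  by rewrite A0 B0 D0 E0 !mx33E; congr mx33; ring.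
- have k2 : N ((Num.sqrt (- N x))^-1 *: x) = -1.
    rewrite NZ exprVn sqr_sqrtr ?oppr_ge0 ?ltW // -[X in _ * X]opprK mulrN.
    by rewrite mulVf // oppr_eq0 lt_eqF.
  have [A isoA cA] := isometry_timelike k2.
  have [einA bA0 eigA] := conjb A _ _ isoA cA; apply: (conjC A isoA).
  move: (_ *m b *m A) einA bA0 eigA
    {conjb conjC xS einb b0} => {}b einb b0.
  rewrite -!rowE => /rowP eqr.
  have b10 : b 1 0 = - b 0 1 by have := eqr 1; rewrite !mxE /=; lra.
  have b20 : b 2 0 = - b 0 2 by have := eqr 2; rewrite !mxE /=; lra.
  apply: skewC => //; move: einb; rewrite (eta_mx33 b) b10 b20.
  rewrite {1}mx33_skew0 => /einstein_mxP[_ _ _ tr0].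
  (* The orthogonal complement of a timelike eigenvector is definite, so tr s^2 is a sum of squares
     and s vanishes. *)
  have /eqP : (b 0 0 ^+ 2 + b 1 1 ^+ 2 + b 2 2 ^+ 2)
      + ((b 0 0 ^+ 2 + b 1 1 ^+ 2 + b 2 2 ^+ 2) + (b 1 2 + b 2 1) ^+ 2) = 0.
    by move: tr0; clear; lra.
  rewrite !paddr_eq0 ?addr_ge0 ?sqr_ge0 // !sqrf_eq0 addr_eq0.
  case/and3P=> /andP[/andP[/eqP b00 /eqP b11] /eqP b22] _ /eqP b12.
  by rewrite b00 b11 b22 b12 !mx33E; congr mx33; ring.
- have x00 : x 0 0 != 0.
    apply: contra_neq x0 => x00.
    have /eqP : x 0 1 ^+ 2 + x 0 2 ^+ 2 = 0.
      by move: N0; rewrite /N x00; clear; lra.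
    rewrite paddr_eq0 ?sqr_ge0 // !sqrf_eq0 => /andP[/eqP x01 /eqP x02].
    by apply/rowP; apply: forall_ord3; rewrite mxE ?x00 ?x01 ?x02.
  have k2 : N ((x 0 0)^-1 *: x) = 0 by rewrite NZ N0 mulr0.
  have [|A isoA cA] := isometry_null k2; first by rewrite mxE mulVf.
  have [einA bA0 eigA] := conjb A _ _ isoA cA; apply: (conjC A isoA).
  move: (_ *m b *m A) einA bA0 eigA
    {conjb conjC xS einb b0} => {}b einb b0.
  rewrite !mulmxBl -!rowE => /rowP eqr.
  have eq0 : b 0 0 - (b 0 2 + b 2 0) / 2 = - (a / 2) by have := eqr 0; rewrite !mxE /=;
    lra.
  have eq1 : (b 0 1 + b 1 0) / 2 = (b 1 2 + b 2 1) / 2 by have := eqr 1;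
    rewrite !mxE /=; lra.
  have eq2 : (b 0 2 + b 2 0) / 2 - b 2 2 = - (a / 2) by have := eqr 2; rewrite !mxE /=;
    lra.
  have bE : b = mx33 (b 0 0) ((b 0 1 + b 1 0) / 2 + (b 0 1 - b 1 0) / 2)
       ((b 0 2 + b 2 0) / 2 + (b 0 2 - b 2 0) / 2)
       ((b 0 1 + b 1 0) / 2 - (b 0 1 - b 1 0) / 2) (b 1 1)
       ((b 1 2 + b 2 1) / 2 + (b 1 2 - b 2 1) / 2)
       ((b 0 2 + b 2 0) / 2 - (b 0 2 - b 2 0) / 2)
       ((b 1 2 + b 2 1) / 2 - (b 1 2 - b 2 1) / 2) (b 2 2).
    by rewrite {1}(eta_mx33 b); congr mx33; field.
  rewrite bE in einb *.
  have [[A0 B0 C0 D0 G0 E0]|] := eqVneq (b 0 0, (b 0 1 + b 1 0) / 2,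
      (b 0 2 + b 2 0) / 2, b 1 1, (b 1 2 + b 2 1) / 2, b 2 2) (0, 0, 0, 0, 0, 0).
    apply: skewC; first by rewrite -bE.
    by rewrite A0 B0 C0 D0 G0 E0 !mx33E; congr mx33; ring.
  by move/eqP => ne; apply: (classifiable_null_eigen ne eq1 eq0 eq2).
Qed.

Lemma einstein_mx_classifiable (b : 'M[R]_3) (x y z : R) : b != 0 ->
  einstein_mx b (mx33 0 x y (- x) 0 z (- y) (- z) 0) ->
  classifiable b (mx33 0 x y (- x) 0 z (- y) (- z) 0).
Proof.
move=> b0; have [[-> -> ->]|/eqP xyz0] := eqVneq (x, y, z) (0, 0, 0).
  by rewrite -mx33_skew0; apply: classifiable_zero.
exact: classifiable_skew_neq0.
Qed.

End Classification.

Import passmx.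

(** * Linear maps and traces *)

(** Evaluates [linfun] at a bare function from a proof of linearity, as the definitions apply it to
    functions without a linear structure. *)
Lemma linfunE (R : nzRingType) (U W : vectType R) (f : U -> W) :
  linear f -> linfun f =1 f.
Proof.
move=> linf x.
pose F : {linear U -> W} := HB.pack f
  (GRing.isSemilinear.Build R U W _ f (GRing.semilinear_linear linf)).
exact: (lfunE F).
Qed.

Lemma linear_comp (R : nzRingType) (U W Z : lmodType R) (f : W -> Z) (h : U -> W) :
  linear f -> linear h -> linear (f \o h).
Proof. by move=> linf linh k x y; rewrite /= linh linf. Qed.

Section Trace.
Variable R : realType.

Lemma lfun_traceC (U W : vectType R) (f : 'Hom(U, W)) (h : 'Hom(W, U)) :
  lfun_trace (f \o h)%VF = lfun_trace (h \o f)%VF.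
Proof.
rewrite /lfun_trace (mxof_comp _ (f := vbasis {:U})) ?vbasisP //.
by rewrite mxtrace_mulC -mxof_comp ?vbasisP.
Qed.

Lemma lfun_trace_basis (W : vectType R) m (b : m.-tuple W) (f : 'End(W)) :
  basis_of fullv b -> lfun_trace f = \sum_i coord b i (f b`_i).
Proof.
move=> basis_b; have mE : m = \dim {:W} by rewrite -(size_basis basis_b) ?size_tuple.
move: b basis_b; rewrite mE => b basis_b.
rewrite /lfun_trace -[f in LHS]comp_lfun1l (mxof_comp _ (f := b)) //.
rewrite mxtrace_mulC -mxof_comp ?vbasisP // comp_lfun1r.
by apply: eq_bigr => i _; rewrite mxE /= vecof_delta mxE.
Qed.

(** By cyclicity. It moves a trace from the subspace type of [Eminus g] to [V], where an orthonormal
    basis is at hand. *)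
Lemma lfun_trace_conj (U W : vectType R) (f : 'End(U)) (phi : 'Hom(U, W))
    (psi : 'Hom(W, U)) :
  (psi \o phi = \1)%VF -> lfun_trace f = lfun_trace (phi \o f \o psi)%VF.
Proof.
by move=> pp; rewrite -comp_lfunA lfun_traceC -comp_lfunA pp comp_lfun1r.
Qed.

End Trace.

(** * The eigenspaces of the generalised metric and the Dorfman bracket on them *)

Section GeneralisedTangent.
Variables (R : realType) (V : vectType R) (br : {bilinear V -> V -> V}).
Variables (H : V -> V -> V -> R) (g : {symmetric V}).
Hypothesis H_form : form3 H.
Hypothesis g_nondeg : nondegenerate g.

Lemma metricC x y : g x y = g y x.
Proof. by rewrite hermC /= mul1r. Qed.

Lemma H1P y z : scalar (fun x => H x y z). Proof. by case: H_form. Qed.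

Lemma H2P x z : scalar (fun y => H x y z). Proof. by case: H_form. Qed.

Lemma H3P x y : scalar (fun z => H x y z). Proof. by case: H_form. Qed.

Lemma metricDl x y z : g (x + y) z = g x z + g y z.
Proof. exact: linearDl. Qed.

Lemma metricZl k x z : g (k *: x) z = k * g x z.
Proof. by rewrite linearZl_LR. Qed.

Lemma metricDr x y z : g z (x + y) = g z x + g z y.
Proof. exact: linearDr. Qed.

Lemma metricZr k x z : g z (k *: x) = k * g z x.
Proof. by rewrite linearZr_LR. Qed.

Lemma metricNl x z : g (- x) z = - g x z.
Proof. by rewrite linearNl. Qed.

Lemma metricNr x z : g z (- x) = - g z x.
Proof. by rewrite linearNr. Qed.

Lemma metric_suml I (r : seq I) (P : pred I) (F : I -> V) z :
  g (\sum_(i <- r | P i) F i) z = \sum_(i <- r | P i) g (F i) z.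
Proof. by rewrite linear_sumlz. Qed.

Lemma metric_sumr I (r : seq I) (P : pred I) (F : I -> V) z :
  g z (\sum_(i <- r | P i) F i) = \sum_(i <- r | P i) g z (F i).
Proof. by rewrite linear_sumr. Qed.

Lemma flatE x y : flat g x y = g x y.
Proof.
have lin2 u : linear (fun y => g u y : R^o) by move=> k v w; rewrite metricDr metricZr.
rewrite linfunE ?linfunE // => k u v; apply/lfunP => w.
by rewrite add_lfunE scale_lfunE !linfunE // metricDl metricZl.
Qed.

Lemma metric_inj x y : (forall z, g x z = g y z) -> x = y.
Proof.
move=> xy; apply/eqP; rewrite -subr_eq0 -memv0 -(eqP g_nondeg).
by apply/mem_orthovP => z _; rewrite metricDl metricNl xy subrr.
Qed.

Lemma flatD x y : flat g (x + y) = flat g x + flat g y.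
Proof. exact: linearD. Qed.

Lemma flatN x : flat g (- x) = - flat g x.
Proof. exact: linearN. Qed.

Lemma flatZ k x : flat g (k *: x) = k *: flat g x.
Proof. exact: linearZ. Qed.

Lemma flat_ker0 : lker (flat g) == 0%VS.
Proof.
apply/lker0P => x y xy; apply: metric_inj => z.
by rewrite -!flatE xy.
Qed.

Lemma flatK : cancel (flat g) (sharp g).
Proof. exact: lker0_lfunK flat_ker0. Qed.

Lemma sharpK : cancel (sharp g) (flat g).
Proof.
move=> a; apply: limg_lfunVK.
suff -> : limg (flat g) = fullv by rewrite memvf.
apply/eqP; rewrite eqEdim subvf limg_dim_eq ?(eqP flat_ker0) ?capv0 //.
by rewrite !dimvf /dim /= muln1.
Qed.

Lemma sharpE a z : g (sharp g a) z = a z.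
Proof. by rewrite -flatE sharpK. Qed.

Lemma GmetricE u : Gmetric g u = (sharp g u.2, flat g u.1).
Proof.
rewrite linfunE // => k v w /=.
by rewrite !linearP.
Qed.

Definition plus_lift (x : V) : gen_tangent V := (x, flat g x).
Definition minus_lift (x : V) : gen_tangent V := (x, - flat g x).

Lemma plus_liftP u : reflect (u = plus_lift u.1) (u \in Eplus g).
Proof.
rewrite memv_ker add_lfunE opp_lfunE scale_lfunE id_lfunE scale1r subr_eq0 GmetricE.
apply: (iffP eqP) => [E|->]; last by rewrite /= flatK.
by case: u E => x a [_ E]; rewrite /plus_lift -E.
Qed.

Lemma minus_liftP u : reflect (u = minus_lift u.1) (u \in Eminus g).
Proof.
rewrite memv_ker add_lfunE opp_lfunE scale_lfunE id_lfunE scaleN1r opprK.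
rewrite addr_eq0 GmetricE.
apply: (iffP eqP) => [E|->]; last first.
  change ((sharp g (- flat g u.1), flat g u.1) = (- u.1, - - flat g u.1)).
  by rewrite [sharp g _]linearN /= flatK opprK.
case: u E => x a [_ E]; rewrite /minus_lift E; congr (_, _).
exact: esym (opprK a).
Qed.

(** By the Koszul formula this is -2 g (nabla_b a, z), where nabla is the metric connection with
    torsion [s * H], the Levi-Civita connection plus [s / 2] times H. *)
Definition connection (s : R) (a b z : V) : R :=
  g (br a b) z + g b (br a z) + g a (br b z) + s * H a b z.

Lemma dorfman2E u v z : (dorfman br H u v).2 z =
  - v.2 (br u.1 z) + u.2 (br v.1 z) + H u.1 v.1 z.
Proof.
rewrite linfunE /d1 ?opprK // => k x y. rewrite !linearDr !linearZr_LR /=.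
by rewrite !linearD !linearZ /= H3P; rewrite /GRing.scale /=; ring.
Qed.

Lemma pi_plus_lift u : pi_plus g u = plus_lift (2^-1 *: (u.1 + sharp g u.2)).
Proof.
rewrite /pi_plus GmetricE /plus_lift flatZ flatD sharpK.
by rewrite [flat _ _ + _]addrC.
Qed.

Lemma pi_minus_lift u : pi_minus g u = minus_lift (2^-1 *: (u.1 - sharp g u.2)).
Proof.
rewrite /pi_minus GmetricE /minus_lift flatZ flatD flatN sharpK.
by rewrite -scalerN opprB.
Qed.

Lemma pi_plus_connection a b z :
  g (pi_plus g (dorfman br H (plus_lift a) (minus_lift b))).1 z =
  2^-1 * connection 1 a b z.
Proof.
rewrite pi_plus_lift -[(plus_lift _).1]/(_ *: _) metricZl metricDl sharpE dorfman2E /=.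
by rewrite opp_lfunE !flatE /connection; ring.
Qed.

Lemma pi_minus_connection a b z :
  g (pi_minus g (dorfman br H (minus_lift b) (plus_lift a))).1 z =
  2^-1 * connection (-1) b a z.
Proof.
rewrite pi_minus_lift -[(minus_lift _).1]/(_ *: _) metricZl metricDl metricNl sharpE
  dorfman2E /=.
by rewrite opp_lfunE !flatE /connection; ring.
Qed.

Lemma dorfman_linear u : linear (dorfman br H u).
Proof.
move=> k v w; rewrite /dorfman; congr (_, _) => /=.
  by rewrite linearDr linearZr_LR.
apply/lfunP => z; rewrite add_lfunE scale_lfunE.
have := dorfman2E u (k *: v + w) z; have := dorfman2E u v z.
have := dorfman2E u w z; rewrite /dorfman /= => -> -> ->.
rewrite add_lfunE scale_lfunE linearDl linearZl_LR [u.2 _]linearP H2P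
  -![_ *: _]/(_ * _) /=.
by rewrite /GRing.scale /=; ring.
Qed.

Lemma pi_plus_linear : linear (pi_plus g).
Proof.
move=> k v w; rewrite /pi_plus linearP /= addrACA -scalerDr.
by rewrite [LHS]scalerDr !scalerA mulrC.
Qed.

Lemma pi_minus_linear : linear (pi_minus g).
Proof.
move=> k v w; rewrite /pi_minus linearP /= opprD addrACA -scalerBr.
by rewrite [LHS]scalerDr !scalerA mulrC.
Qed.

Lemma Gamma_plusE u w : Gamma_plus br H u w =
  vsproj (Eplus g) (pi_plus g (dorfman br H (vsval u) (vsval w))).
Proof.
apply: linfunE; apply: (linear_comp (@vsproj_is_linear _ _ _)).
apply: (linear_comp pi_plus_linear); apply: (linear_comp (dorfman_linear _)).
exact: vsval_is_linear.
Qed.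

Lemma Gamma_minusE v w : Gamma_minus br H v w =
  vsproj (Eminus g) (pi_minus g (dorfman br H (vsval v) (vsval w))).
Proof.
apply: linfunE; apply: (linear_comp (@vsproj_is_linear _ _ _)).
apply: (linear_comp pi_minus_linear); apply: (linear_comp (dorfman_linear _)).
exact: vsval_is_linear.
Qed.

End GeneralisedTangent.

(** * The trace of the curvature operator in a pseudo-orthonormal basis *)

Section RicciTrace.
Variables (R : realType) (V : vectType R) (br : {bilinear V -> V -> V}).
Variables (H : V -> V -> V -> R) (g : {symmetric V}).
Hypothesis H_form : form3 H.
Hypothesis g_nondeg : nondegenerate g.

Lemma connectionP1 s b z : scalar (fun a => connection br H g s a b z).
Proof.
move=> k x y; rewrite /connection !(linearDl, linearZl_LR) !(metricDr, metricZr) /=.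
by rewrite (H1P H_form); ring.
Qed.

Lemma connectionP2 s a z : scalar (fun b => connection br H g s a b z).
Proof.
move=> k x y; rewrite /connection !(linearDr, linearZr_LR) !(linearDl, linearZl_LR) /=.
by rewrite metricDr metricZr (H2P H_form); ring.
Qed.

Lemma scalar_sum (f : V -> R) I (r : seq I) (P : pred I) (k : I -> R) (x : I -> V) :
  scalar f ->
  f (\sum_(i <- r | P i) k i *: x i) = \sum_(i <- r | P i) k i * f (x i).
Proof.
move=> linf; elim/big_rec2: _ => [|i y1 y2 _ <-]; last exact: linf.
(* The case of the empty sum: this instance yields [f 0 = 0]. *)
have := linf (-1) 0 0; rewrite scaler0 addr0 => f0.
by move: f0; lra.
Qed.

Lemma minus_lift_mem x : minus_lift g x \in Eminus g.
Proof. exact/minus_liftP. Qed.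

Lemma pi_plus_mem w : pi_plus g w \in Eplus g.
Proof. by rewrite pi_plus_lift //; apply/plus_liftP. Qed.

Lemma pi_minus_mem w : pi_minus g w \in Eminus g.
Proof. by rewrite pi_minus_lift //; apply/minus_liftP. Qed.

Lemma Gamma_plus_val u w : vsval (Gamma_plus (g := g) br H u w) =
  pi_plus g (dorfman br H (vsval u) (vsval w)).
Proof. rewrite Gamma_plusE //; exact: (vsprojK (pi_plus_mem _)). Qed.

Lemma Gamma_minus_val v w : vsval (Gamma_minus (g := g) br H v w) =
  pi_minus g (dorfman br H (vsval v) (vsval w)).
Proof. rewrite Gamma_minusE //; exact: (vsprojK (pi_minus_mem _)). Qed.

Section OrthogonalBasis.
Variables (m : nat) (t : m.-tuple V) (tau : 'I_m -> R).
Hypothesis t_basis : basis_of {:V} t.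
Hypothesis t_ortho : forall i j : 'I_m,
  g t`_i t`_j = if i == j then tau i else 0.
Hypothesis tau_sqr : forall i, tau i ^+ 2 = 1.

Lemma coord_orthogonal i x : coord t i x = tau i * g x t`_i.
Proof.
rewrite [x in RHS](coord_basis t_basis) ?memvf // metric_suml.
rewrite (bigD1 i) //= big1 ?addr0 => [|j ji].
  by rewrite metricZl t_ortho eqxx mulrCA -expr2 tau_sqr mulr1.
by rewrite metricZl t_ortho (negPf ji) mulr0.
Qed.

(** Each of the two projections contributes a factor 1/2, and each index a sign [tau], because the
    coordinate along a basis vector is [tau] times the product with it. *)
Lemma lfun_trace_Gamma u v a b :
  vsval u = plus_lift g a -> vsval v = minus_lift g b ->
  lfun_trace (Gamma_minus br H v \o Gamma_plus (g := g) br H u)%VF =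
  4^-1 * \sum_i \sum_j tau i * tau j *
    (connection br H g 1 a t`_i t`_j *
     connection br H g (-1) b t`_j t`_i).
Proof.
move=> uE vE.
pose phi : 'Hom(subvs_of (Eminus g), V) := linfun (fun w => (vsval w).1).
pose psi : 'Hom(V, subvs_of (Eminus g)) :=
  linfun (fun x => vsproj (Eminus g) (minus_lift g x)).
have phiE w : phi w = (vsval w).1.
  by apply: linfunE.
have minus_lift_linear : linear (minus_lift g).
  move=> k x y; rewrite /minus_lift flatD flatZ opprD -scalerN; reflexivity.
have psiE x : psi x = vsproj (Eminus g) (minus_lift g x).
  apply: linfunE; exact: (linear_comp (@vsproj_is_linear _ _ _) minus_lift_linear).
have psiK : (psi \o phi = \1)%VF.
  apply/lfunP => w; rewrite comp_lfunE id_lfunE psiE phiE.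
  by rewrite -(elimT (minus_liftP g_nondeg _) (subvsP w)) vsvalK.
rewrite (lfun_trace_conj _ psiK) (lfun_trace_basis _ t_basis) mulr_sumr.
apply: eq_bigr => i _; rewrite coord_orthogonal !comp_lfunE phiE.
have E1 : vsval (psi t`_i) = minus_lift g t`_i.
  rewrite psiE; exact: (vsprojK (minus_lift_mem _)).
have E2 : vsval (Gamma_plus br H u (psi t`_i)) =
    pi_plus g (dorfman br H (plus_lift g a) (minus_lift g t`_i)).
  by rewrite -E1 -uE; apply: Gamma_plus_val.
have E3 : vsval (Gamma_minus br H v (Gamma_plus br H u (psi t`_i))) =
    pi_minus g (dorfman br H (minus_lift g b)
      (pi_plus g (dorfman br H (plus_lift g a) (minus_lift g t`_i)))).
  by rewrite -E2 -vE; apply: Gamma_minus_val.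
apply: etrans (congr1 (fun w => tau i * g w.1 t`_i) E3) _.
have /(plus_liftP g_nondeg) -> :=
  pi_plus_mem (dorfman br H (plus_lift g a) (minus_lift g t`_i)).
rewrite pi_minus_connection //.
set p := (pi_plus g _).1.
have -> : p = \sum_j (tau j * (2^-1 * connection br H g 1 a t`_i t`_j)) *: t`_j.
  rewrite {1}[p](coord_basis t_basis) ?memvf //.
  by apply: eq_bigr => j _; rewrite coord_orthogonal pi_plus_connection.
rewrite (scalar_sum _ _ _ _ (connectionP2 _ _ _)) !mulr_sumr.
by apply: eq_bigr => j _; field.
Qed.

End OrthogonalBasis.
End RicciTrace.

Section EinsteinTrace.
Variables (R : realType) (V : vectType R) (br : {bilinear V -> V -> V}).
Variables (H : V -> V -> V -> R) (g : {symmetric V}).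
Hypothesis H_form : form3 H.
Hypothesis g_nondeg : nondegenerate g.

Section OrthogonalBasis.
Variables (m : nat) (t : m.-tuple V) (tau : 'I_m -> R).
Hypothesis t_ortho : forall i j : 'I_m,
  g t`_i t`_j = if i == j then tau i else 0.
Hypothesis tau_sqr : forall i, tau i ^+ 2 = 1.

Lemma orthogonal_basis (U : {vspace V}) :
  (forall i : 'I_m, t`_i \in U) -> (\dim U <= m)%N -> basis_of U t.
Proof.
move=> tU dimU; rewrite basisEfree size_tuple dimU andbT; apply/andP; split.
  apply/freeP => k k0 i; have := congr1 (g^~ t`_i) k0.
  rewrite metric_suml (bigD1 i) //= big1 ?addr0 => [|j ji]; last first.
    by rewrite metricZl t_ortho (negPf ji) mulr0.
  rewrite metricZl t_ortho eqxx linear0l => /(congr1 ( *%R^~ (tau i))).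
  by rewrite mul0r -mulrA -expr2 tau_sqr mulr1.
by apply/span_subvP => x /(nthP 0)[i]; rewrite size_tuple => im <-;
  apply: (tU (Ordinal im)).
Qed.

(** For zero divergence both curvatures are minus the same trace, which is bilinear in the base
    vectors of u and v; so pairs of basis vectors suffice. *)
Lemma gen_einsteinP : basis_of {:V} t ->
  gen_einstein br H g 0 <-> forall k l : 'I_m,
    \sum_i \sum_j tau i * tau j *
      (connection br H g 1 t`_k t`_i t`_j *
       connection br H g (-1) t`_l t`_j t`_i) = 0.
Proof.
move=> t_basis.
have plusE a : vsval (vsproj (Eplus g) (plus_lift g a)) = plus_lift g a.
  by apply: vsprojK; apply/plus_liftP.
have minusE a : vsval (vsproj (Eminus g) (minus_lift g a)) = minus_lift g a.
  by apply: vsprojK; apply/minus_liftP.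
have trE := lfun_trace_Gamma br H_form g_nondeg t_basis t_ortho tau_sqr.
split=> [[ein _] k l|ein].
  have := ein (vsproj _ (minus_lift g t`_l)) (vsproj _ (plus_lift g t`_k)).
  rewrite /RC_plus zero_lfunE addr0 (trE _ _ _ _ (plusE _) (minusE _)).
  by move=> /eqP; rewrite oppr_eq0 mulf_eq0 invr_eq0 pnatr_eq0 => /eqP.
have sum0 a b : \sum_i \sum_j tau i * tau j *
    (connection br H g 1 a t`_i t`_j * connection br H g (-1) b t`_j t`_i) = 0.
  rewrite (coord_basis t_basis (memvf a)) (coord_basis t_basis (memvf b)).
  transitivity (\sum_k \sum_l coord t k a * coord t l b *
      \sum_i \sum_j tau i * tau j *
      (connection br H g 1 t`_k t`_i t`_j *
       connection br H g (-1) t`_l t`_j t`_i)); last first.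
    by rewrite big1 // => k _; rewrite big1 // => l _; rewrite ein mulr0.
  have eq1 i j : tau i * tau j *
     (connection br H g 1 (\sum_k coord t k a *: t`_k) t`_i t`_j *
      connection br H g (-1) (\sum_l coord t l b *: t`_l) t`_j t`_i) =
    \sum_k \sum_l coord t k a * coord t l b * (tau i * tau j *
      (connection br H g 1 t`_k t`_i t`_j *
       connection br H g (-1) t`_l t`_j t`_i)).
    rewrite !(scalar_sum _ _ _ _ (connectionP1 _ _ H_form _ _ _)) // big_distrlr
      mulr_sumr.
    by apply: eq_bigr => k _; rewrite mulr_sumr; apply: eq_bigr => l _ /=; ring.
  under eq_bigr => i _ do under eq_bigr => j _ do rewrite eq1.
  under eq_bigr => i _ do rewrite exchange_big /=.
  rewrite exchange_big /=; apply: eq_bigr => k _.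
  under eq_bigr => i _ do rewrite exchange_big /=.
  rewrite exchange_big /=; apply: eq_bigr => l _.
  by rewrite mulr_sumr; apply: eq_bigr => i _; rewrite mulr_sumr.
have tr0 u v : lfun_trace (Gamma_minus br H v \o Gamma_plus (g := g) br H u)%VF = 0.
  have /(plus_liftP g_nondeg) uE := subvsP u.
  have /(minus_liftP g_nondeg) vE := subvsP v.
  by rewrite (trE _ _ _ _ uE vE) sum0 mulr0.
by split=> [v u|u v]; rewrite /RC_plus /RC_minus zero_lfunE addr0 tr0 oppr0.
Qed.

End OrthogonalBasis.
End EinsteinTrace.

Lemma forall_ord4 (P : 'I_4 -> Prop) : P 0 -> P 1 -> P 2 -> P 3 -> forall i, P i.
Proof.
move=> P0 P1 P2 P3 [[|[|[|[|//]]]] Hi].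
- by have -> : Ordinal Hi = 0 by exact/val_inj.
- by have -> : Ordinal Hi = 1 by exact/val_inj.
- by have -> : Ordinal Hi = 2 by exact/val_inj.
- by have -> : Ordinal Hi = 3 by exact/val_inj.
Qed.

(** * The sixteen traces in an adapted frame, as polynomials *)

Section Table.
Variable R : realType.
Variables (b h : nat -> nat -> R) (vol : nat -> nat -> nat -> R) (eps eta : R).

Definition frame_sign (i : nat) : R := nth 0 [:: - eps; eps; eps; eta] i.

(** Index 3 stands for X; [b], [h], [vol] stand for g ([X, .], .), H (X, ., .) and H on n. Natural
    numbers as indices let every entry compute once the sums over the ordinals are unfolded. *)
Definition frame_table (s : R) (i j k : nat) : R :=
  if i == 3%N then
    if (j == 3%N) || (k == 3%N) then 0 else b j k + b k j + s * h j k
  else if j == 3%N then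
    if k == 3%N then 0 else - b i k + b k i - s * h i k
  else if k == 3%N then - b i j - b j i + s * h i j
  else s * vol i j k.

(** Four times the trace of the composite of Gamma_v and Gamma_u, for u over the frame vector [k]
    and v over the frame vector [l]. *)
Let S k l : R := \sum_(i < 4) \sum_(j < 4) frame_sign i * frame_sign j *
  (frame_table 1 k i j * frame_table (-1) l j i).

Hypothesis h_alt : forall i, h i i = 0.
Hypothesis h_anti : forall i j, h j i = - h i j.
Hypothesis vol_alt12 : forall i j, vol i i j = 0.
Hypothesis vol_alt23 : forall i j, vol i j j = 0.
Hypothesis vol_anti12 : forall i j k, vol j i k = - vol i j k.
Hypothesis vol_anti23 : forall i j k, vol i k j = - vol i j k.

Let vol_alt13 i j : vol i j i = 0.
Proof. by rewrite vol_anti23 vol_alt12 oppr0. Qed.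
Let vol120 : vol 1 2 0 = vol 0 1 2.
Proof. by rewrite (vol_anti23 1 0 2) (vol_anti12 0 1) opprK. Qed.
Let vol201 : vol 2 0 1 = vol 0 1 2.
Proof. by rewrite (vol_anti12 0 2) (vol_anti23 0 1 2) opprK. Qed.
Let vol210 : vol 2 1 0 = - vol 0 1 2.
Proof. by rewrite (vol_anti12 1 2) vol120. Qed.

Let tableE := (h_alt, h_anti 0 1, h_anti 0 2, h_anti 1 2, vol_alt12, vol_alt23,
  vol_alt13, vol_anti23 0 1 2, vol_anti12 0 1 2, vol120, vol201, vol210).

Ltac table_simpl :=
  rewrite /S !big_ord_recl !big_ord0 /frame_table /frame_sign /= !tableE
    !(mul0r, mulr0, add0r, addr0, subr0, sub0r).

Lemma table_sum00 : S 0 0 = eps * eta * (- (b 1 0 - b 0 1 - h 0 1) *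
  (b 0 1 + b 1 0 + h 0 1) - (b 0 1 + b 1 0 - h 0 1) * (b 1 0 - b 0 1 + h 0 1)
  - (b 2 0 - b 0 2 - h 0 2) * (b 0 2 + b 2 0 + h 0 2)
  - (b 0 2 + b 2 0 - h 0 2) * (b 2 0 - b 0 2 + h 0 2)) + 2 * eps ^+ 2 * vol 0 1 2 ^+ 2.
Proof. by table_simpl; ring. Qed.

Lemma table_sum01 : S 0 1 = eps * eta * ((b 0 0 + b 0 0) * (b 0 1 - b 1 0 - h 0 1)
  - (b 1 0 - b 0 1 - h 0 1) * (b 1 1 + b 1 1)
  - (b 2 0 - b 0 2 - h 0 2) * (b 1 2 + b 2 1 + h 1 2)
  - (b 0 2 + b 2 0 - h 0 2) * (b 2 1 - b 1 2 + h 1 2)).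
Proof. by table_simpl; ring. Qed.

Lemma table_sum02 : S 0 2 = eps * eta * ((b 0 0 + b 0 0) * (b 0 2 - b 2 0 - h 0 2)
  - (b 1 0 - b 0 1 - h 0 1) * (b 2 1 + b 1 2 - h 1 2)
  - (b 0 1 + b 1 0 - h 0 1) * (b 1 2 - b 2 1 - h 1 2)
  - (b 2 0 - b 0 2 - h 0 2) * (b 2 2 + b 2 2)).
Proof. by table_simpl; ring. Qed.

Lemma table_sum10 : S 1 0 = eps * eta * ((b 0 1 - b 1 0 + h 0 1) * (b 0 0 + b 0 0)
  - (b 1 1 + b 1 1) * (b 1 0 - b 0 1 + h 0 1)
  - (b 2 1 - b 1 2 - h 1 2) * (b 0 2 + b 2 0 + h 0 2)
  - (b 1 2 + b 2 1 - h 1 2) * (b 2 0 - b 0 2 + h 0 2)).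
Proof. by table_simpl; ring. Qed.

Lemma table_sum11 : S 1 1 = eps * eta * ((b 0 1 - b 1 0 + h 0 1) *
  (b 1 0 + b 0 1 - h 0 1) + (b 1 0 + b 0 1 + h 0 1) * (b 0 1 - b 1 0 - h 0 1)
  - (b 2 1 - b 1 2 - h 1 2) * (b 1 2 + b 2 1 + h 1 2)
  - (b 1 2 + b 2 1 - h 1 2) * (b 2 1 - b 1 2 + h 1 2)) - 2 * eps ^+ 2 * vol 0 1 2 ^+ 2.
Proof. by table_simpl; ring. Qed.

Lemma table_sum12 : S 1 2 = eps * eta * ((b 0 1 - b 1 0 + h 0 1) *
  (b 2 0 + b 0 2 - h 0 2) + (b 1 0 + b 0 1 + h 0 1) * (b 0 2 - b 2 0 - h 0 2)
  - (b 1 1 + b 1 1) * (b 1 2 - b 2 1 - h 1 2)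
  - (b 2 1 - b 1 2 - h 1 2) * (b 2 2 + b 2 2)).
Proof. by table_simpl; ring. Qed.

Lemma table_sum20 : S 2 0 = eps * eta * ((b 0 2 - b 2 0 + h 0 2) * (b 0 0 + b 0 0)
  - (b 1 2 - b 2 1 + h 1 2) * (b 0 1 + b 1 0 + h 0 1)
  - (b 2 1 + b 1 2 + h 1 2) * (b 1 0 - b 0 1 + h 0 1)
  - (b 2 2 + b 2 2) * (b 2 0 - b 0 2 + h 0 2)).
Proof. by table_simpl; ring. Qed.

Lemma table_sum21 : S 2 1 = eps * eta * ((b 0 2 - b 2 0 + h 0 2) *
  (b 1 0 + b 0 1 - h 0 1) + (b 2 0 + b 0 2 + h 0 2) * (b 0 1 - b 1 0 - h 0 1)
  - (b 1 2 - b 2 1 + h 1 2) * (b 1 1 + b 1 1)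
  - (b 2 2 + b 2 2) * (b 2 1 - b 1 2 + h 1 2)).
Proof. by table_simpl; ring. Qed.

Lemma table_sum22 : S 2 2 = eps * eta * ((b 0 2 - b 2 0 + h 0 2) *
  (b 2 0 + b 0 2 - h 0 2) + (b 2 0 + b 0 2 + h 0 2) * (b 0 2 - b 2 0 - h 0 2)
  - (b 1 2 - b 2 1 + h 1 2) * (b 2 1 + b 1 2 - h 1 2)
  - (b 2 1 + b 1 2 + h 1 2) * (b 1 2 - b 2 1 - h 1 2)) - 2 * eps ^+ 2 * vol 0 1 2 ^+ 2.
Proof. by table_simpl; ring. Qed.

Lemma table_sum33 : S 3 3 = 2 * eps ^+ 2 * (2 * (b 0 0 ^+ 2 + b 1 1 ^+ 2 + b 2 2 ^+ 2)
  - (b 0 1 + b 1 0) ^+ 2 - (b 0 2 + b 2 0) ^+ 2 + (b 1 2 + b 2 1) ^+ 2 - h 0 1 ^+ 2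
  - h 0 2 ^+ 2 + h 1 2 ^+ 2).
Proof. by table_simpl; ring. Qed.

Lemma table_sum3 : [/\ S 3 0 = 2 * eps ^+ 2 * vol 0 1 2 * h 1 2,
  S 3 1 = 2 * eps ^+ 2 * vol 0 1 2 * h 0 2 & S 3 2 =
    - 2 * eps ^+ 2 * vol 0 1 2 * h 0 1].
Proof. by split; table_simpl; ring. Qed.

(** On the block of n, once [vol 0 1 2 = 0], the part symmetric in [k] and [l] is [s, k] = W^2 / 2
    and the skew part is {s, W} + [k, W] = 0. The entry at X, X is tr s^2 = 0 up to a multiple of tr
    W^2, which the trace of the first equation makes zero. *)
Lemma table_einsteinP (eps_sign : eps = -1 \/ eps = 1) (eta_sign : eta = -1 \/ eta = 1)
  :
  (forall k l : 'I_4, S k l = 0) <->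
  vol 0 1 2 = 0 /\
  einstein_mx (mx33 (eps * b 0 0) (eps * b 0 1) (eps * b 0 2)
                    (eps * b 1 0) (eps * b 1 1) (eps * b 1 2)
                    (eps * b 2 0) (eps * b 2 1) (eps * b 2 2))
    (mx33 0 (eps * h 0 1) (eps * h 0 2) (- (eps * h 0 1)) 0 (eps * h 1 2)
          (- (eps * h 0 2)) (- (eps * h 1 2)) 0).
Proof.
have eps2 : eps ^+ 2 = 1 by case: eps_sign => ->; rewrite ?sqrrN expr1n.
rewrite einstein_mxP; split.
  move=> S0; have S0' k l : (k < 4)%N -> (l < 4)%N -> S k l = 0.
    by move=> kl ll; apply: (S0 (Ordinal kl) (Ordinal ll)).
  have [s30 s31 s32] := table_sum3.
  have := S0' 3 0 isT isT; have := S0' 3 1 isT isT; have := S0' 3 2 isT isT.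
  rewrite {}s30 {}s31 {}s32 eps2 => s32 s31 s30.
  have := S0' 3 3 isT isT; rewrite table_sum33 eps2.
  have := S0' 0 0 isT isT; rewrite table_sum00 eps2.
  have := S0' 0 1 isT isT; rewrite table_sum01.
  have := S0' 0 2 isT isT; rewrite table_sum02.
  have := S0' 1 0 isT isT; rewrite table_sum10.
  have := S0' 1 1 isT isT; rewrite table_sum11 eps2.
  have := S0' 1 2 isT isT; rewrite table_sum12.
  have := S0' 2 0 isT isT; rewrite table_sum20.
  have := S0' 2 1 isT isT; rewrite table_sum21.
  have := S0' 2 2 isT isT; rewrite table_sum22 eps2.
  move=> s22 s21 s20 s12 s11 s10 s02 s01 s00 s33.
  have c0 : vol 0 1 2 = 0.
    have ch01 : vol 0 1 2 * h 0 1 = 0 by move: s32; lra.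
    have ch02 : vol 0 1 2 * h 0 2 = 0 by move: s31; lra.
    have ch12 : vol 0 1 2 * h 1 2 = 0 by move: s30; lra.
    (* The trace of the block on n with respect to the metric: the commutator drops out, being
       traceless. *)
    have c2 : 6 * vol 0 1 2 ^+ 2 = 4 * eps * eta * (h 1 2 ^+ 2 - h 0 1 ^+ 2
      - h 0 2 ^+ 2).
      by move: s00 s11 s22; lra.
    (* One more factor [vol 0 1 2] annihilates the right-hand side of [c2]. *)
    have : vol 0 1 2 ^+ 2 * vol 0 1 2 = 0.
      have -> : vol 0 1 2 ^+ 2 = 4 * eps * eta * (h 1 2 ^+ 2 - h 0 1 ^+ 2 - h 0 2 ^+ 2)
        / 6.
        by rewrite -c2; field.
      rewrite (_ : _ * vol 0 1 2 = 4 * eps * eta * (h 1 2 * (vol 0 1 2 * h 1 2)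
        - h 0 1 * (vol 0 1 2 * h 0 1)
        - h 0 2 * (vol 0 1 2 * h 0 2)) / 6); last by field.
      by rewrite ch01 ch02 ch12; ring.
    by move/eqP; rewrite mulf_eq0 sqrf_eq0 orbb => /eqP.
  split=> //; rewrite c0 {s30 s31 s32 S0 S0' eps2} in s00 s11 s22 *.
  move: s22 s21 s20 s12 s11 s10 s02 s01 s00 s33.
  by case: eps_sign => ->; case: eta_sign => -> s22 s21 s20 s12 s11 s10 s02 s01 s00 s33;
    (split; [split|split|split|]); lra.
case=> c0 [[e11 e22 e33] [e12 e13 e23] [d12 d13 d23] tr0].
have sk3 : [/\ S 0 3 = 0, S 1 3 = 0 & S 2 3 = 0].
  by split; table_simpl; rewrite c0; ring.
have s3k : [/\ S 3 0 = 0, S 3 1 = 0 & S 3 2 = 0].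
  by have [-> -> ->] := table_sum3; split; rewrite c0; ring.
have [[s03 s13 s23] [s30 s31 s32]] := (sk3, s3k).
have [s00 s01 s02] : [/\ S 0 0 = 0, S 0 1 = 0 & S 0 2 = 0].
  rewrite table_sum00 table_sum01 table_sum02 c0 eps2.
  move: e11 e22 e33 e12 e13 e23 d12 d13 d23.
  by case: eps_sign => ->; case: eta_sign => -> *; split; lra.
have [s10 s11 s12] : [/\ S 1 0 = 0, S 1 1 = 0 & S 1 2 = 0].
  rewrite table_sum10 table_sum11 table_sum12 c0 eps2.
  move: e11 e22 e33 e12 e13 e23 d12 d13 d23.
  by case: eps_sign => ->; case: eta_sign => -> *; split; lra.
have [s20 s21 s22] : [/\ S 2 0 = 0, S 2 1 = 0 & S 2 2 = 0].
  rewrite table_sum20 table_sum21 table_sum22 c0 eps2.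
  move: e11 e22 e33 e12 e13 e23 d12 d13 d23.
  by case: eps_sign => ->; case: eta_sign => -> *; split; lra.
have s33 : S 3 3 = 0.
  rewrite table_sum33 eps2; move: e11 e22 e33 tr0.
  by case: eps_sign => -> *; lra.
by do 2!apply: forall_ord4.
Qed.

End Table.

(** * Alternating three-forms *)

Section Form3.
Variables (R : realType) (V : vectType R) (H : V -> V -> V -> R).
Hypothesis H_form : form3 H.

Lemma form3_alt12 x z : H x x z = 0. Proof. by case: H_form => _ _ _ /(_ x z)[]. Qed.

Lemma form3_alt23 x z : H z x x = 0. Proof. by case: H_form => _ _ _ /(_ z x)[]. Qed.

Lemma form3_anti12 x y z : H y x z = - H x y z.
Proof.
have := form3_alt12 (x + y) z; have D := H1P H_form; have E := H2P H_form.
rewrite -[x in x + y]scale1r D !E !form3_alt12; lra.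
Qed.

Lemma form3_anti23 x y z : H x z y = - H x y z.
Proof.
have := form3_alt23 (y + z) x; have D := H2P H_form; have E := H3P H_form.
rewrite -[y in y + z]scale1r D !E !form3_alt23; lra.
Qed.

Lemma form3_alt13 x y : H x y x = 0.
Proof. by rewrite form3_anti23 form3_alt12 oppr0. Qed.

Lemma form3_frame_mx (k : R) (X : V) (e : 3.-tuple V) :
  \matrix_(i < 3, j < 3) (k * H X e`_i e`_j) =
    mx33 0 (k * H X e`_0 e`_1) (k * H X e`_0 e`_2)
      (- (k * H X e`_0 e`_1)) 0 (k * H X e`_1 e`_2)
      (- (k * H X e`_0 e`_2)) (- (k * H X e`_1 e`_2)) 0.
Proof.
rewrite [LHS]eta_mx33 !mxE /= !form3_alt23 mulr0.
rewrite (form3_anti23 X e`_0 e`_1) (form3_anti23 X e`_0 e`_2).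
by rewrite (form3_anti23 X e`_1 e`_2) !mulrN.
Qed.

End Form3.

(** * Connection coefficients of an almost Abelian algebra *)

Section AlmostAbelian.
Variables (R : realType) (V : vectType R) (br : {bilinear V -> V -> V}).
Variables (H : V -> V -> V -> R) (g : {symmetric V}).
Variables (n : {vspace V}) (X : V) (eta eps : R) (e : 3.-tuple V).
Hypothesis V_dim : \dim {:V} = 4%N.
Hypothesis br_lie : lie_bracket br.
Hypothesis H_form : form3 H.
Hypothesis g_nondeg : nondegenerate g.
Hypothesis n_ideal : codim1_abelian_ideal br n.
Hypothesis X_ortho : X \in orthov g n.
Hypothesis X_norm : g X X = eta.
Hypothesis eta_sign : eta = -1 \/ eta = 1.
Hypothesis eps_sign : eps = -1 \/ eps = 1.
Hypothesis e_adapted : adapted_basis g n eps e.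

Let t : 4.-tuple V := rcons_tuple e X.
Let tau (i : 'I_4) : R := frame_sign eps eta i.

Lemma frame_nth : [/\ t`_0 = e`_0, t`_1 = e`_1, t`_2 = e`_2 & t`_3 = X].
Proof. by rewrite /= !nth_rcons !size_tuple. Qed.

Lemma frame_ideal (i : 'I_3) : e`_i \in n.
Proof.
by have [/andP[/eqP <- _] _ _ _ _] := e_adapted; rewrite memv_span ?mem_nth ?size_tuple.
Qed.

Lemma ideal_ortho y : y \in n -> g y X = 0.
Proof. by move=> yn; rewrite metricC; move/mem_orthovP: X_ortho; apply. Qed.

Lemma frame_ortho (i j : 'I_4) : g t`_i t`_j = if i == j then tau i else 0.
Proof.
have [_ off e00 e11 e22] := e_adapted.
have [t0 t1 t2 t3] := frame_nth.
have n0 := frame_ideal 0; have n1 := frame_ideal 1; have n2 := frame_ideal 2.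
move: i j; do 2!apply: forall_ord4; rewrite /tau /frame_sign ?t0 ?t1 ?t2 ?t3 //=.
- exact: (off 0 1).
- exact: (off 0 2).
- exact: ideal_ortho.
- exact: (off 1 0).
- exact: (off 1 2).
- exact: ideal_ortho.
- exact: (off 2 0).
- exact: (off 2 1).
- exact: ideal_ortho.
- by rewrite metricC ideal_ortho.
- by rewrite metricC ideal_ortho.
- by rewrite metricC ideal_ortho.
Qed.

Lemma frame_sign_sqr i : tau i ^+ 2 = 1.
Proof.
rewrite /tau /frame_sign; case: eps_sign => ->; case: eta_sign => ->;
  by move: i; apply: forall_ord4; rewrite /= ?opprK ?sqrrN expr1n.
Qed.

Lemma frame_basis : basis_of {:V} t.
Proof.
by apply: (orthogonal_basis frame_ortho frame_sign_sqr) => [i|]; rewrite ?memvf ?V_dim.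
Qed.

Lemma br_anti x y : br y x = - br x y.
Proof.
have [br0 _] := br_lie; have /eqP := br0 (x + y).
by rewrite linearDl !linearDr /= !br0 add0r addr0 addr_eq0 => /eqP->; rewrite opprK.
Qed.

Let bf y z := g (br X y) z.

Lemma br_ideal_l y : y \in n -> br X y \in n.
Proof. by move=> yn; have [_ + _] := n_ideal; apply. Qed.

Lemma br_ideal y z : y \in n -> z \in n -> br y z = 0.
Proof. by move=> yn zn; have [_ _] := n_ideal; apply. Qed.

Lemma connection_XX s z : (z \in n) || (z == X) -> connection br H g s X X z = 0.
Proof.
rewrite /connection (form3_alt12 H_form) (proj1 br_lie) linear0l mulr0 addr0 add0r.
case/orP => [zn|/eqP->]; last by rewrite (proj1 br_lie) linear0r addr0.
by rewrite metricC ideal_ortho ?addr0 // br_ideal_l.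
Qed.

Lemma connection_Xn s y z : y \in n -> z \in n ->
  connection br H g s X y z = bf y z + bf z y + s * H X y z.
Proof.
move=> yn zn; rewrite /connection (br_ideal yn zn) linear0r addr0.
by rewrite [g y _]metricC.
Qed.

Lemma connection_XnX s y : y \in n -> connection br H g s X y X = 0.
Proof.
move=> yn; rewrite /connection (form3_alt13 H_form) (proj1 br_lie) linear0r.
rewrite mulr0 !addr0 ideal_ortho ?br_ideal_l // add0r metricC br_anti.
by rewrite metricNl ideal_ortho ?br_ideal_l // oppr0.
Qed.

Lemma connection_nXX s y : y \in n -> connection br H g s y X X = 0.
Proof.
move=> yn; rewrite /connection (form3_alt23 H_form) (proj1 br_lie) linear0r.
rewrite mulr0 !addr0 [g X _]metricC br_anti metricNl ideal_ortho ?br_ideal_l //.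
by rewrite oppr0 addr0.
Qed.

Lemma connection_nnn s x y z : x \in n -> y \in n -> z \in n ->
  connection br H g s x y z = s * H x y z.
Proof.
move=> xn yn zn; rewrite /connection !br_ideal //.
by rewrite linear0l !linear0r !add0r.
Qed.

Lemma connection_nXn s y z : y \in n -> z \in n ->
  connection br H g s y X z = - bf y z + bf z y - s * H X y z.
Proof.
move=> yn zn; rewrite /connection (br_ideal yn zn) linear0r addr0 br_anti metricNl.
by rewrite [g y _]metricC (form3_anti12 H_form X y) mulrN.
Qed.

Lemma connection_nnX s y z : y \in n -> z \in n ->
  connection br H g s y z X = - bf y z - bf z y + s * H X y z.
Proof.
move=> yn zn; rewrite /connection (br_ideal yn zn) linear0l add0r.
rewrite !(br_anti X) !linearNr /= ![g _ (br _ _)]metricC.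
by rewrite (form3_anti23 H_form y X) (form3_anti12 H_form X y) opprK addrC
  [- bf _ _ - _]addrC addrC.
Qed.

Lemma frame_connection s (i j k : 'I_4) : connection br H g s t`_i t`_j t`_k =
  frame_table (fun i j => bf e`_i e`_j) (fun i j => H X e`_i e`_j)
    (fun i j k => H e`_i e`_j e`_k) s i j k.
Proof.
have tE (l : 'I_4) : (l == 3 :> nat) /\ t`_l = X \/
    ((l == 3 :> nat) = false /\ t`_l = e`_l /\ t`_l \in n).
  have [t0 t1 t2 t3] := frame_nth.
  move: l; apply: forall_ord4; [right|right|right|left];
    rewrite ?t0 ?t1 ?t2 ?t3 //; do 2!split=> //.
  - exact: (frame_ideal 0).
  - exact: (frame_ideal 1).
  - exact: (frame_ideal 2).
rewrite /frame_table.
have [[-> ->]|[-> [<- ni]]] := tE i; have [[-> ->]|[-> [<- nj]]] := tE j;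
  have [[-> ->]|[-> [<- nk]]] := tE k => /=.
- by rewrite connection_XX ?eqxx ?orbT.
- by rewrite connection_XX ?nk.
- by rewrite connection_XnX.
- by rewrite connection_Xn.
- by rewrite connection_nXX.
- by rewrite connection_nXn.
- by rewrite connection_nnX.
- by rewrite connection_nnn.
Qed.

Lemma einstein_frameP : gen_einstein br H g 0 <->
  H e`_0 e`_1 e`_2 = 0 /\
  einstein_mx (\matrix_(i, j) (eps * g (br X e`_i) e`_j))
              (\matrix_(i, j) (eps * H X e`_i e`_j)).
Proof.
rewrite (form3_frame_mx H_form) [X in einstein_mx X]eta_mx33 !mxE /=.
rewrite (gen_einsteinP br H_form g_nondeg frame_ortho frame_sign_sqr frame_basis).
rewrite -(@table_einsteinP R (fun i j => bf e`_i e`_j) (fun i j => H X e`_i e`_j)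
   (fun i j k => H e`_i e`_j e`_k) eps eta) //.
- split=> ein k l; rewrite -[RHS](ein k l); apply: eq_bigr => i _;
    by apply: eq_bigr => j _; rewrite !frame_connection.
- by move=> i; rewrite (form3_alt23 H_form).
- by move=> i j; rewrite (form3_anti23 H_form).
- by move=> i j; rewrite (form3_alt12 H_form).
- by move=> i j; rewrite (form3_alt23 H_form).
- by move=> i j k; rewrite (form3_anti12 H_form).
- by move=> i j k; rewrite (form3_anti23 H_form).
Qed.

End AlmostAbelian.

(** * Existence and change of adapted bases *)

Section Frames.
Variables (R : realType) (V : vectType R) (g : {symmetric V}) (n : {vspace V}).
Variable (X : V).
Hypothesis g_nondeg : nondegenerate g.
Hypothesis n_dim : (\dim n).+1 = \dim {:V}.
Hypothesis X_ortho : X \in orthov g n.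
Hypothesis X_norm : g X X = -1 \/ g X X = 1.

(** The ideal lies in the orthogonal complement of X, and both have codimension one because X is not
    in the radical. *)
Lemma mem_ideal z : (z \in n) = (g z X == 0).
Proof.
have X_rad : X \notin orthov g fullv.
  rewrite (eqP g_nondeg) memv0; apply/eqP => X0.
  by case: X_norm; rewrite X0 linear0r; lra.
rewrite -mem_orthov1; suff -> : n = orthov g <[X]> by [].
apply/eqP; rewrite eqEdim -mem_orthov_sym X_ortho /=.
have := leqif_dim_orthov1_full g X; rewrite -n_dim => /(_ isT) [_].
by rewrite X_rad eqn_leq => /andP[].
Qed.

(* The map is the reflection exchanging c0 with X or - X. *)
Lemma reflection_frame c0 : g c0 c0 = g X X ->
  exists r : V -> V, (forall v, g c0 v = 0 -> r v \in n) /\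
    (forall v w, g c0 v = 0 -> g c0 w = 0 -> g (r v) (r w) = g v w).
Proof.
move=> c0X; have X0 : g X X != 0 by case: X_norm => ->; rewrite ?oppr_eq0 oner_neq0.
(* Take [Y] to be X or - X. The vector [Y - c0] has square [2 * (g X X - g Y c0)], so the choice
   makes it non-null and the reflection along it exists. *)
have [Y [YX YY]] : exists Y, [/\ forall z, (g z X == 0) = (g z Y == 0), g Y Y = g X X &
    g Y c0 != g X X].
  have [Xc|Xc] := eqVneq (g X c0) (g X X); last by exists X.
  exists (- X); split=> [z||]; rewrite ?metricNl ?metricNr ?opprK ?oppr_eq0 //.
  by rewrite Xc eq_sym -addr_eq0; apply: contra_neq X0 => X0; lra.
rewrite eq_sym -subr_eq0; set k := g X X - g Y c0 => k0.
exists (fun v => v - (g Y v / k) *: (Y - c0)); split=> [v v0|v w v0 w0].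
  rewrite mem_ideal YX metricDl metricNl metricZl metricDl metricNl YY.
  by rewrite [g c0 Y]metricC -/k divfK // [g v Y]metricC subrr.
rewrite !(metricDl, metricDr, metricNl, metricNr, metricZl, metricZr) w0 YY c0X.
rewrite [g v Y]metricC [g v c0]metricC [g c0 Y]metricC v0.
rewrite (_ : g Y c0 = g X X - k); first by field.
by rewrite /k opprB addrCA subrr addr0.
Qed.

Lemma frame_of_mem eps (e : 3.-tuple V) : eps = -1 \/ eps = 1 ->
  (forall i : 'I_3, e`_i \in n) -> \dim n = 3%N ->
  \matrix_(i, j) (eps * g e`_i e`_j) = lorentz R -> adapted_basis g n eps e.
Proof.
move=> eps_sign en dim_n gram.
have eps2 : eps * eps = 1 by case: eps_sign => ->; rewrite ?mulrNN mulr1.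
have gE (i j : 'I_3) : g e`_i e`_j = eps * lorentz R i j.
  by rewrite -gram mxE mulrA eps2 mul1r.
have off (i j : 'I_3) : i != j -> g e`_i e`_j = 0.
  by move: i j; do 2!apply: forall_ord3; rewrite ?gE ?mxE /= ?mulr0.
have [e0 e1 e2] : [/\ g e`_0 e`_0 = - eps, g e`_1 e`_1 = eps & g e`_2 e`_2 = eps].
  by split; [rewrite (gE 0 0)|rewrite (gE 1 1)|rewrite (gE 2 2)];
    rewrite mxE /= ?mulrN mulr1.
split=> //; apply: (orthogonal_basis (g := g) (tau := fun i => eps * lorentz R i i)) =>
  //.
- move=> i j; case: eqVneq => [->|/off //]; exact: gE.
- by apply: forall_ord3; rewrite !mxE /= ?mulrN ?mulr1 ?sqrrN expr2.
- by rewrite dim_n.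
Qed.

End Frames.

Lemma adapted_gram (R : realType) (V : vectType R) (g : {symmetric V})
    (n : {vspace V}) eps (e : 3.-tuple V) : eps = -1 \/ eps = 1 ->
  adapted_basis g n eps e -> \matrix_(i, j) (eps * g e`_i e`_j) = lorentz R.
Proof.
move=> eps_sign [_ off e0 e1 e2].
have eps2 : eps * eps = 1 by case: eps_sign => ->; rewrite ?mulrNN mulr1.
apply/matrixP; do 2!apply: forall_ord3; rewrite !mxE /= ?e0 ?e1 ?e2 ?mulrN ?eps2 //.
- by rewrite (off 0 1) ?mulr0.
- by rewrite (off 0 2) ?mulr0.
- by rewrite (off 1 0) ?mulr0.
- by rewrite (off 1 2) ?mulr0.
- by rewrite (off 2 0) ?mulr0.
- by rewrite (off 2 1) ?mulr0.
Qed.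

(** Choose a vector of the given basis with the same square as X. The reflection carrying it to X or
    - X carries the other three into n, where two have square [- g X X] and one has square
    [g X X]. *)
Lemma exists_adapted_basis (R : realType) (V : vectType R) (g : {symmetric V})
    (n : {vspace V}) (X : V) :
  nondegenerate g -> has_signature g 2 2 -> \dim {:V} = 4%N ->
  (\dim n).+1 = \dim {:V} -> X \in orthov g n ->
  g X X = -1 \/ g X X = 1 -> exists e, adapted_basis g n (- g X X) e.
Proof.
move=> g_nondeg [c [_ cE]] V_dim n_dim X_ortho X_norm.
have n3 : \dim n = 3%N by apply: succn_inj; rewrite n_dim V_dim.
have frame v0 v1 v2 v3 : g v0 v0 = g X X -> g v1 v1 = g X X ->
    g v2 v2 = - g X X -> g v3 v3 = - g X X ->
    [/\ g v0 v1 = 0, g v0 v2 = 0, g v0 v3 = 0 &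
      [/\ g v1 v2 = 0, g v1 v3 = 0 & g v2 v3 = 0]] ->
    exists e, adapted_basis g n (- g X X) e.
  move=> g00 g11 g22 g33 [g01 g02 g03 [g12 g13 g23]].
  have [r [rn rg]] := reflection_frame g_nondeg n_dim X_ortho X_norm g00.
  exists [tuple r v1; r v2; r v3]; apply: frame_of_mem => //.
  - by case: X_norm => ->; rewrite ?opprK; [right|left].
  - by apply: forall_ord3 => /=; apply: rn.
  have gXX2 : g X X * g X X = 1 by case: X_norm => ->; rewrite ?mulrNN mulr1.
  have g21 : g v2 v1 = 0 by rewrite metricC.
  have g31 : g v3 v1 = 0 by rewrite metricC.
  have g32 : g v3 v2 = 0 by rewrite metricC.
  apply/matrixP; do 2!apply: forall_ord3; rewrite !mxE /= rg //
    ?(g11, g22, g33, g12, g13, g23, g21, g31, g32);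
    by rewrite ?mulr0 ?mulrNN ?mulNr ?gXX2.
have {}cE i j (il : (i < 4)%N) (jl : (j < 4)%N) := cE (Ordinal il) (Ordinal jl).
case: X_norm => gX; rewrite gX ?opprK in frame |- *.
  by apply: (frame c`_3 c`_2 c`_0 c`_1); rewrite ?opprK;
    [exact: (cE 3 3)|exact: (cE 2 2)|exact: (cE 0 0)|exact: (cE 1 1)|split;
      [exact: (cE 3 2)|exact: (cE 3 0)|exact: (cE 3 1)|split;
      [exact: (cE 2 0)|exact: (cE 2 1)|exact: (cE 0 1)]]].
by apply: (frame c`_0 c`_1 c`_2 c`_3);
  [exact: (cE 0 0)|exact: (cE 1 1)|exact: (cE 2 2)|exact: (cE 3 3)|split;
    [exact: (cE 0 1)|exact: (cE 0 2)|exact: (cE 0 3)|split;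
    [exact: (cE 1 2)|exact: (cE 1 3)|exact: (cE 2 3)]]].
Qed.

Lemma sum_ord4 (U : nmodType) (F : 'I_4 -> U) :
  \sum_(i < 4) F i = F 0 + F 1 + F 2 + F 3.
Proof.
rewrite !big_ord_recl big_ord0 addr0 !addrA.
by congr (_ + F _ + F _ + F _); apply/val_inj.
Qed.

Definition change_frame (R : realType) (V : vectType R) (e : 3.-tuple V)
    (M : 'M[R]_3) : 3.-tuple V :=
  [tuple \sum_(k < 3) M k i *: e`_k | i < 3].

Lemma change_frame_form (R : realType) (V : vectType R) (e : 3.-tuple V) M
    (Q : V -> V -> R) :
  (forall y, scalar (Q^~ y)) -> (forall x, scalar (Q x)) ->
  \matrix_(i, j) Q (change_frame e M)`_i (change_frame e M)`_j =
  M^T *m (\matrix_(i, j) Q e`_i e`_j) *m M.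
Proof.
move=> Q1 Q2; apply/matrixP => i j; rewrite !mxE -!tnth_nth !tnth_mktuple.
rewrite (scalar_sum _ _ _ _ (Q1 _)).
under eq_bigr => k _ do rewrite (scalar_sum _ _ _ _ (Q2 _)) mulr_sumr.
rewrite exchange_big; apply: eq_bigr => l _ /=; rewrite !mxE mulr_suml.
by apply: eq_bigr => k _; rewrite !mxE; ring.
Qed.

Lemma change_frame_mem (R : realType) (V : vectType R) (e : 3.-tuple V) M
    (n : {vspace V}) (i : 'I_3) :
  (forall i : 'I_3, e`_i \in n) -> (change_frame e M)`_i \in n.
Proof.
move=> en; rewrite -tnth_nth tnth_mktuple.
by apply: memv_suml => k _; apply: memvZ.
Qed.

(** * Reading f and H off an adapted frame *)

Section FrameForms.
Variables (R : realType) (V : vectType R) (br : {bilinear V -> V -> V}).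
Variables (H : V -> V -> V -> R) (g : {symmetric V}).
Variables (n : {vspace V}) (X : V) (eta eps : R) (e : 3.-tuple V).
Hypothesis V_dim : \dim {:V} = 4%N.
Hypothesis br_lie : lie_bracket br.
Hypothesis H_form : form3 H.
Hypothesis g_nondeg : nondegenerate g.
Hypothesis n_ideal : codim1_abelian_ideal br n.
Hypothesis X_ortho : X \in orthov g n.
Hypothesis X_norm : g X X = eta.
Hypothesis eta_sign : eta = -1 \/ eta = 1.
Hypothesis eps_sign : eps = -1 \/ eps = 1.
Hypothesis e_adapted : adapted_basis g n eps e.

(** By non-degeneracy it suffices to pair with the frame: on n the Gram matrix is [eps] times the
    Lorentzian one, and the products with X vanish because n is an ideal. *)
Lemma representsP F : represents (br X) e F <->
  \matrix_(i, j) (eps * g (br X e`_i) e`_j) = F^T *m lorentz R.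
Proof.
have gram := adapted_gram eps_sign e_adapted.
have eps2 : eps * eps = 1 by case: eps_sign => ->; rewrite ?mulrNN mulr1.
have ein := frame_ideal e_adapted.
have E (j k : 'I_3) : eps * g (\sum_(i < 3) F i j *: e`_i) e`_k = (F^T *m lorentz R) j
  k.
  rewrite metric_suml mulr_sumr mxE; apply: eq_bigr => i _.
  by rewrite metricZl [F^T _ _]mxE mulrCA -gram mxE.
split=> [repF|FE j]; first by apply/matrixP => i k; rewrite mxE repF E.
apply: (metric_inj g_nondeg) => z.
have tb := frame_basis V_dim X_ortho X_norm eta_sign eps_sign e_adapted.
have [t0 t1 t2 t3] := frame_nth X e.
rewrite (coord_basis tb (memvf z)) !metric_sumr.
have eqk (k : 'I_3) : g (br X e`_j) e`_k = g (\sum_(i < 3) F i j *: e`_i) e`_k.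
  have := E j k; rewrite -FE mxE => /(congr1 ( *%R eps)).
  by rewrite !mulrA eps2 !mul1r.
have eqX : g (br X e`_j) X = g (\sum_(i < 3) F i j *: e`_i) X.
  have [_ brn _] := n_ideal.
  rewrite !(ideal_ortho X_ortho) ?brn //.
  by apply: memv_suml => i _; apply: memvZ.
apply: eq_bigr; apply: forall_ord4 => _; rewrite !metricZr.
- by rewrite [_`_0]t0 (eqk 0).
- by rewrite [_`_1]t1 (eqk 1).
- by rewrite [_`_2]t2 (eqk 2).
- by rewrite [_`_3]t3 eqX.
Qed.

(** A three-form in dimension four has four components; without the one on n, only those that
    contain X are left. *)
Lemma form3_coframe : H e`_0 e`_1 e`_2 = 0 -> forall x y z,
  H x y z = H X e`_0 e`_1 * wedge21 (wedge11 (coframe e X 0) (coframe e X 1))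
    (coframe e X 3) x y z
    + H X e`_0 e`_2 * wedge21 (wedge11 (coframe e X 0) (coframe e X 2)) (coframe e X 3)
      x y z
    + H X e`_1 e`_2 * wedge21 (wedge11 (coframe e X 1) (coframe e X 2)) (coframe e X 3)
      x y z.
Proof.
move=> c0 x y z.
have tb := frame_basis V_dim X_ortho X_norm eta_sign eps_sign e_adapted.
have [t0 t1 t2 t3] := frame_nth X e.
have sumE v : v = coframe e X 0 v *: e`_0 + (coframe e X 1 v *: e`_1 +
    (coframe e X 2 v *: e`_2 + (coframe e X 3 v *: X + 0))).
  by rewrite {1}(coord_basis tb (memvf v)) sum_ord4 t0 t1 t2 t3 addr0 !addrA.
rewrite {1}(sumE x) {1}(sumE y) {1}(sumE z) /wedge21 /wedge11.
move: (coframe e X 0 x) (coframe e X 1 x) (coframe e X 2 x) (coframe e X 3 x).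
move: (coframe e X 0 y) (coframe e X 1 y) (coframe e X 2 y) (coframe e X 3 y).
move: (coframe e X 0 z) (coframe e X 1 z) (coframe e X 2 z) (coframe e X 3 z).
move=> z0 z1 z2 z3 y0 y1 y2 y3 x0 x1 x2 x3 {x y z sumE}.
have D1 := H1P H_form; have D2 := H2P H_form; have D3 := H3P H_form.
have H1 y z : H 0 y z = 0 by have := D1 y z (-1) 0 0; rewrite scaler0 addr0; lra.
have H2 x z : H x 0 z = 0 by have := D2 x z (-1) 0 0; rewrite scaler0 addr0; lra.
have H3 x y : H x y 0 = 0 by have := D3 x y (-1) 0 0; rewrite scaler0 addr0; lra.
have A12 := form3_anti12 H_form; have A23 := form3_anti23 H_form.
have cE : [/\ H e`_0 e`_2 e`_1 = 0, H e`_1 e`_0 e`_2 = 0, H e`_1 e`_2 e`_0 = 0,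
    H e`_2 e`_0 e`_1 = 0 & H e`_2 e`_1 e`_0 = 0].
  have c021 : H e`_0 e`_2 e`_1 = 0 by rewrite A23 c0 oppr0.
  have c102 : H e`_1 e`_0 e`_2 = 0 by rewrite A12 c0 oppr0.
  have c120 : H e`_1 e`_2 e`_0 = 0 by rewrite A23 c102 oppr0.
  by split=> //; rewrite A12 ?c021 ?c120 oppr0.
case: cE => c021 c102 c120 c201 c210.
have XE (u v : V) : [/\ H u X v = - H X u v & H u v X = H X u v].
  by split; rewrite ?(A23 u X) A12 ?opprK.
rewrite !D1 !D2 !D3 !H1 !H2 !H3 !(form3_alt12 H_form, form3_alt13 H_form,
  form3_alt23 H_form).
rewrite c0 c021 c102 c120 c201 c210.
rewrite !(fun u v => proj1 (XE u v)) !(fun u v => proj2 (XE u v)).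
rewrite (A23 X e`_0 e`_1) (A23 X e`_0 e`_2) (A23 X e`_1 e`_2).
by ring.
Qed.

End FrameForms.

Lemma einstein_normal_form (R : realType) (F w : 'M[R]_3) :
  normal_form F w -> einstein_mx (F^T *m lorentz R) w.
Proof.
have zero_w (b : 'M[R]_3) : w = 0 -> einstein_mx b (mx33 0 0 0 (- 0) 0 0 (- 0) (- 0) 0)
  ->
    einstein_mx b w.
  by move=> ->; rewrite -mx33_skew0.
case=> [[w0 [s ->]]|[w0 [al [a [_ ->]]]]|[w0 [ep [v [eps_sign ->]]]]|[a [-> ->]]].
- apply: zero_w => //; rewrite !mx33E einstein_mxP.
  by split; [split|split|split|]; ring.
- apply: zero_w => //=; have : Num.sqrt (al ^+ 2 + a ^+ 2 / 2) ^+ 2 = al ^+ 2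
  + a ^+ 2 / 2.
    by rewrite sqr_sqrtr // addr_ge0 ?divr_ge0 ?sqr_ge0.
  move: (Num.sqrt _) => be beE; rewrite !mx33E einstein_mxP.
  by split; [split|split|split|]; move: beE; lra.
- apply: zero_w => //; rewrite !mx33E einstein_mxP.
  by split; [split|split|split|]; ring.
- have : (Num.sqrt 2)^-1 ^+ 2 = 2^-1 :> R by rewrite exprVn sqr_sqrtr.
  move: (_^-1) => r r2; rewrite !mx33E.
  have := einstein_mxP; move=> /(_ R _ _ _ _ _ _ _ _ _ (- a) 0 a).
  rewrite opprK oppr0 => ->.
  have r2a : r ^+ 2 * (2 * a ^+ 2) = a ^+ 2 by rewrite r2; field.
  by split; [split|split|split|]; move: r2a; rewrite ?sqrrN ?expr0n /= ?mulr0; lra.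
Qed.

Section TwistedForms.
Variables (R : realType) (V : vectType R) (br : {bilinear V -> V -> V}).
Variables (H : V -> V -> V -> R) (g : {symmetric V}).
Variables (n : {vspace V}) (X : V) (eta eps : R) (e : 3.-tuple V).
Hypothesis V_dim : \dim {:V} = 4%N.
Hypothesis br_lie : lie_bracket br.
Hypothesis H_form : form3 H.
Hypothesis g_nondeg : nondegenerate g.
Hypothesis n_ideal : codim1_abelian_ideal br n.
Hypothesis X_ortho : X \in orthov g n.
Hypothesis X_norm : g X X = eta.
Hypothesis eta_sign : eta = -1 \/ eta = 1.
Hypothesis eps_sign : eps = -1 \/ eps = 1.
Hypothesis e_adapted : adapted_basis g n eps e.

(** As n is Abelian, the bracket is determined by ad_X on n. *)
Lemma frame_br_neq0 : ~ lie_abelian br ->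
  \matrix_(i < 3, j < 3) (eps * g (br X e`_i) e`_j) != 0.
Proof.
move=> nab; apply/eqP => b0; apply: nab.
have rep0 : represents (br X) e 0.
  apply/(representsP V_dim g_nondeg n_ideal X_ortho X_norm eta_sign eps_sign e_adapted).
  by rewrite b0 trmx0 mul0mx.
have brX (i : 'I_3) : br X e`_i = 0.
  by rewrite rep0 big1 // => k _; rewrite mxE scale0r.
have tb := frame_basis V_dim X_ortho X_norm eta_sign eps_sign e_adapted.
have [t0 t1 t2 t3] := frame_nth X e.
have en := frame_ideal e_adapted; have [br0 _] := br_lie.
have [_ _ ab] := n_ideal.
have brt (i : 'I_4) : br X (rcons_tuple e X)`_i = 0.
  move: i; apply: forall_ord4.
  - by rewrite [_`_0]t0 (brX 0).
  - by rewrite [_`_1]t1 (brX 1).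
  - by rewrite [_`_2]t2 (brX 2).
  - by rewrite [_`_3]t3 br0.
have brXz z : br X z = 0.
  rewrite (coord_basis tb (memvf z)) linear_sumr big1 // => i _.
  by rewrite linearZr_LR /= brt // scaler0.
have split_z z : exists2 y, y \in n & exists k, z = y + k *: X.
  have zE := coord_basis tb (memvf z).
  rewrite sum_ord4 [_`_0]t0 [_`_1]t1 [_`_2]t2 [_`_3]t3 in zE.
  eexists; last by eexists; exact: zE.
  by rewrite !memvD ?memvZ ?(en 0) ?(en 1) ?(en 2).
move=> x y; have [x' x'n [k ->]] := split_z x; have [y' y'n [l ->]] := split_z y.
rewrite linearDl !linearDr /= ab // !(linearZl_LR, linearZr_LR) /=.
by rewrite (br_anti br_lie X x') !brXz oppr0 !scaler0 !addr0.
Qed.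

Lemma metric_coframe x : g X x = eta * coframe e X 3 x.
Proof.
have [t0 t1 t2 t3] := frame_nth X e.
have en := frame_ideal e_adapted.
have tb := frame_basis V_dim X_ortho X_norm eta_sign eps_sign e_adapted.
have o (i : 'I_3) : g X e`_i = 0 by rewrite metricC (ideal_ortho X_ortho).
rewrite {1}(coord_basis tb (memvf x)) metric_sumr sum_ord4 !metricZr.
by rewrite [_`_0]t0 [_`_1]t1 [_`_2]t2 [_`_3]t3 (o 0) (o 1) (o 2) X_norm !mulr0 !add0r
  mulrC.
Qed.

Lemma twisted_coframe a x y z :
  wedge21 (fun x y => a * (e12 e X x y - e23 e X x y)) (g X) x y z =
  eta * a * wedge21 (wedge11 (coframe e X 0) (coframe e X 1)) (coframe e X 3) x y z
  - eta * a * wedge21 (wedge11 (coframe e X 1) (coframe e X 2)) (coframe e X 3) x y z.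
Proof.
have i0 : inord 0 = 0 :> 'I_4 by apply: val_inj; rewrite /= inordK.
have i1 : inord 1 = 1 :> 'I_4 by apply: val_inj; rewrite /= inordK.
have i2 : inord 2 = 2 :> 'I_4 by apply: val_inj; rewrite /= inordK.
by rewrite /e12 /e23 i0 i1 i2 /wedge21 !metric_coframe; ring.
Qed.

Lemma coframe_nth (i j : 'I_4) :
  coframe e X i (rcons_tuple e X)`_j = (i == j)%:R.
Proof.
have tb := frame_basis V_dim X_ortho X_norm eta_sign eps_sign e_adapted.
by rewrite /coframe coord_free ?(basis_free tb) // eq_sym.
Qed.

Lemma twisted_frame a :
  (forall x y z, H x y z =
    wedge21 (fun x y => a * (e12 e X x y - e23 e X x y)) (g X) x y z) ->
  [/\ H e`_0 e`_1 e`_2 = 0, H X e`_0 e`_1 = eta * a, H X e`_0 e`_2 = 0 &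
      H X e`_1 e`_2 = - (eta * a)].
Proof.
move=> HE; rewrite !HE !twisted_coframe /wedge21 /wedge11.
have [t0 t1 t2 t3] := frame_nth X e.
have cE (i : 'I_4) : [/\ coframe e X i e`_0 = (i == 0)%:R,
  coframe e X i e`_1 = (i == 1)%:R,
    coframe e X i e`_2 = (i == 2)%:R & coframe e X i X = (i == 3)%:R].
  split; [rewrite -t0|rewrite -t1|rewrite -t2|rewrite -{2}t3].
  - exact: (coframe_nth i 0).
  - exact: (coframe_nth i 1).
  - exact: (coframe_nth i 2).
  - exact: (coframe_nth i 3).
have [-> -> -> ->] := cE 0; have [-> -> -> ->] := cE 1; have [-> -> -> ->] := cE 2.
have [-> -> -> ->] := cE 3.
by split; rewrite /=; ring.
Qed.

End TwistedForms.
Theorem corollary4p7 (R : realType) (V : vectType R)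
    (br : {bilinear V -> V -> V}) (H : V -> V -> V -> R) (g : {symmetric V})
    (n : {vspace V}) (X : V)
    (hdim : \dim {:V} = 4%N)
    (hgen : gen_pseudo_riemannian_lie_algebra br H g)
    (hsig : has_signature g 2 2)
    (hnab : ~ lie_abelian br)
    (hn : codim1_abelian_ideal br n)
    (hnn : nondegenerate_on g n)
    (hXn : X \in orthov g n)
    (hX : g X X = -1 \/ g X X = 1) :
  gen_einstein br H g 0 <->
  exists (eps : R) (e : 3.-tuple V),
    [/\ eps = -1 \/ eps = 1,
        adapted_basis g n eps e &
        ((forall x y z, H x y z = 0) /\
         exists s : R,
           represents (br X) e
             (mx33     0      0    (-1 + s)
                       0      0    (-1 - s)
                    (-1 + s) (1 + s)   0    ))
        \/
        ((forall x y z, H x y z = 0) /\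
         exists alpha a : R, (alpha, a) <> (0, 0) /\
           let beta := Num.sqrt (alpha ^+ 2 + a ^+ 2 / 2) in
           represents (br X) e
             (mx33 alpha (- beta) 0
                   beta   alpha   0
                    0       0     a))
        \/
        ((forall x y z, H x y z = 0) /\
         exists epsilon v : R, (epsilon = -1 \/ epsilon = 1) /\
           represents (br X) e
             (mx33   (epsilon / 2)     (epsilon / 2)     v
                   (- (epsilon / 2)) (- (epsilon / 2)) (- v)
                          v                 v            0  ))
        \/
        ((forall x y z, H x y z = 0) /\
         represents (br X) e
           ((Num.sqrt 2)^-1 *:
             mx33 0 (-1) 0
                  1   0  1
                  0   1  0))
        \/
        (exists a : R, [/\ a <> 0,
           forall x y z, H x y z =
             wedge21 (fun x y => a * (e12 e X x y - e23 e X x y)) (g X) x y z &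
           represents (br X) e
             ((Num.sqrt 2)^-1 *:
               mx33       0         (-1 - a ^+ 2 / 2)       0
                    (1 - a ^+ 2 / 2)        0        (1 - a ^+ 2 / 2)
                          0         (1 + a ^+ 2 / 2)        0        )])].
Proof.
have [br_lie H_form _ g_nondeg] := hgen.
have [n_dim _ _] := hn.
have V_dim := hdim; have n3 : \dim n = 3%N by apply: succn_inj; rewrite n_dim.
have frameE eps e := @einstein_frameP _ _ br H g n X (g X X) eps e hdim br_lie
  H_form g_nondeg hn hXn erefl hX.
have reprE eps e := @representsP _ _ br g n X (g X X) eps e hdim g_nondeg hn hXn
  erefl hX.
have HE eps e := @form3_coframe _ _ H g n X (g X X) eps e hdim H_form hXn erefl hX.
have wE eps e := form3_frame_mx H_form eps X e.
have mxE' eps (Q : V -> V -> R) e M : (forall y, scalar (Q^~ y)) ->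
    (forall x, scalar (Q x)) ->
    \matrix_(i < 3, j < 3) (eps * Q (change_frame e M)`_i (change_frame e M)`_j) =
    M^T *m (\matrix_(i < 3, j < 3) (eps * Q e`_i e`_j)) *m M.
  move=> Q1 Q2; apply: (change_frame_form _ _ (Q := fun x y => eps * Q x y)).
  - by move=> y k u v; rewrite Q1; ring.
  - by move=> x k u v; rewrite Q2; ring.
split=> [ein|].
  have [e0 e0_adapted] := exists_adapted_basis g_nondeg hsig hdim n_dim hXn hX.
  have etaE : g X X = - (- g X X) by rewrite opprK.
  move: (- g X X) etaE e0_adapted => eps etaE e0_adapted.
  have eps_sign : eps = -1 \/ eps = 1.
    by rewrite -[eps]opprK -etaE; case: hX => ->; [right; rewrite opprK|left].
  have eps2 : eps * eps = 1 by case: eps_sign => ->; rewrite ?mulrNN mulr1.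
  have [c0 ein0] := (frameE _ _ eps_sign e0_adapted).1 ein.
  have b0 := frame_br_neq0 hdim br_lie g_nondeg hn hXn erefl hX eps_sign e0_adapted
    hnab.
  rewrite wE in ein0; have := einstein_mx_classifiable b0 ein0; rewrite -wE.
  case=> M [F [isoM FE nf]].
  pose e := change_frame e0 M.
  have e_adapted : adapted_basis g n eps e.
    apply: frame_of_mem => //.
      by move=> i; apply: change_frame_mem; apply: frame_ideal e0_adapted.
    rewrite mxE'; first by rewrite (adapted_gram eps_sign e0_adapted).
    - by move=> y k u v; rewrite metricDl metricZl.
    - by move=> y k u v; rewrite metricDr metricZr.
  (* Applying the criterion to the new frame gives the vanishing of H on n there, without the
     determinant of [M]. *)
  have [c0' _] := (frameE _ _ eps_sign e_adapted).1 ein.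
  have repF : represents (br X) e F.
    apply/(reprE _ _ eps_sign e_adapted); rewrite -FE.
    rewrite (mxE' eps (fun x y => g (br X x) y)) //.
    - by move=> y k u v; rewrite linearDr linearZr_LR /= metricDl metricZl.
    - by move=> y k u v; rewrite metricDr metricZr.
  rewrite -(mxE' eps (H X)) in nf; last 2 first.
  - by move=> y; apply: H2P.
  - by move=> y; apply: H3P.
  rewrite -/e wE in nf.
  have HeE := HE _ _ eps_sign e_adapted c0'.
  have cancel_eps u v : eps * u = v -> u = eps * v.
    by move=> <-; rewrite mulrA eps2 mul1r.
  have H0 : mx33 0 (eps * H X e`_0 e`_1) (eps * H X e`_0 e`_2)
      (- (eps * H X e`_0 e`_1)) 0 (eps * H X e`_1 e`_2)
      (- (eps * H X e`_0 e`_2)) (- (eps * H X e`_1 e`_2)) 0 = 0 ->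
      forall x y z, H x y z = 0.
    rewrite [X in _ = X]mx33_0 => /mx33_inj[[_ h01 h02] [_ _ h12] _] x y z.
    rewrite HeE (cancel_eps _ _ h01) (cancel_eps _ _ h02) (cancel_eps _ _ h12).
    by rewrite mulr0 !mul0r !addr0.
  exists eps, e; split=> //.
  case: nf => [[w0 [s FsE]]|[w0 [al [a [nz FsE]]]]|[w0 [ep [v [ep_sign FsE]]]]|[a
    [w0 FsE]]].
  - by left; split; [exact: H0|exists s; rewrite -FsE].
  - by right; left; split; [exact: H0|exists al, a; split=> //; rewrite /= -FsE].
  - by right; right; left; split; [exact: H0|exists ep, v; split=> //; rewrite -FsE].
  have [a0|a0] := eqVneq a 0.
    right; right; right; left; split.
      by apply: H0; rewrite w0 a0 !oppr0 -mx33_0.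
    move: repF; rewrite FsE a0; congr (represents _ _ (_ *: _)).
    by congr mx33; ring.
  right; right; right; right; exists a; split; [exact/eqP| |by rewrite -FsE].
  (* From [eps * H X e_1 e_2 = - a] one gets [H X e_1 e_2 = - eps * a], which is [g X X * a] because
     [g X X = - eps]; this is the coefficient in the wedge with X^flat. *)
  move=> x y z; rewrite (twisted_coframe hdim hXn erefl hX eps_sign e_adapted) HeE.
  have [[_ h01 h02] [_ _ h12] _] := mx33_inj w0.
  rewrite (cancel_eps _ _ h01) (cancel_eps _ _ h02) (cancel_eps _ _ h12) etaE.
  by ring.
case=> eps [e [eps_sign e_adapted nf]].
have einE F : H e`_0 e`_1 e`_2 = 0 -> represents (br X) e F ->
    normal_form F (\matrix_(i < 3, j < 3) (eps * H X e`_i e`_j)) ->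
    gen_einstein br H g 0.
  move=> c0 /(reprE _ _ eps_sign e_adapted) repF nfF.
  apply/(frameE _ _ eps_sign e_adapted); split=> //.
  by rewrite repF; apply: einstein_normal_form.
have w0 : (forall x y z, H x y z = 0) ->
    \matrix_(i < 3, j < 3) (eps * H X e`_i e`_j) = 0.
  by move=> H0; apply/matrixP => i j; rewrite !mxE H0 mulr0.
case: nf => [[H0 [s rep]]|[[H0 [al [a [nz rep]]]]|[[H0
  [ep [v [ep_sign rep]]]]|[[H0 rep]|[a [a0 HaE rep]]]]]].
- by apply: (einE _ _ rep) => //; apply: Or41; split; [exact: w0|exists s].
- by apply: (einE _ _ rep) => //; apply: Or42; split; [exact: w0|exists al, a].
- by apply: (einE _ _ rep) => //; apply: Or43; split; [exact: w0|exists ep, v].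
- apply: (einE _ _ rep) => //; apply: Or44; exists 0; split.
    by rewrite (w0 H0) oppr0 -mx33_0.
  by congr (_ *: mx33 _ _ _ _ _ _ _ _ _); ring.
- have [c0 h01 h02 h12] := twisted_frame hdim hXn erefl hX eps_sign e_adapted HaE.
  (* The parameter of the normal form is [a] up to sign, whatever the two signs [eps] and [g X X]
     are; the matrix of f contains only its square. *)
  apply: (einE _ c0 rep); apply: Or44; exists (- (eps * (g X X * a))); split.
    by rewrite wE h01 h02 h12; congr mx33; ring.
  have signs2 : eps ^+ 2 * g X X ^+ 2 = 1.
    by case: eps_sign => ->; case: hX => ->; rewrite ?sqrrN !expr1n mulr1.
  have -> : (- (eps * (g X X * a))) ^+ 2 = a ^+ 2.
    by rewrite sqrrN !exprMn mulrA signs2 mul1r.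
  by [].
Qed.
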